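(* One has $K^{\mathbb{N}}_{Church}=_{\rm ct}K^{\mathbb{Z}}_{Church}\upharpoonright\mathbb{N}=_{\rm ct}K^{\mathbb{Z}}_{\Delta Church}\upharpoonright\mathbb{N}$ and, as functions on $\mathbb N$, $$\log\ >_{\rm ct}\ K^{\mathbb{N}}_{Church}\ >_{\rm ct}\ K^{\mathbb{N}}_{card}\ >_{\rm ct}\ K^{\mathbb{Z}}_{\Delta card}\upharpoonright\mathbb{N}\ >_{\rm ct}\ K^{\mathbb{N}}_{index}\ >_{\rm ct}\ K^{\mathbb{Z}}_{\Delta index}\upharpoonright\mathbb{N}.$$
   Context: For $f,g:D\to\mathbb{N}$: $f\leq_{\rm ct} g$ means $\exists c\,\forall x\in D\ f(x)\leq g(x)+c$; $f=_{\rm ct}g$ means $f\leq_{\rm ct}g$ and $g\leq_{\rm ct}f$; $g>_{\rm ct}f$ means $f\leq_{\rm ct}g$ and not $g\leq_{\rm ct}f$. $\log$ is the (integer part of the) base 2 logarithm, with value $0$ at $0$. $\mathbf{2}^*$ is the set of finite binary words, $|p|$ the length of $p$. Equality between values of partial functions means both undefined, or both defined and equal. $\upharpoonright\mathbb N$ is restriction to $\mathbb N$. Self-enumerated systems. A self-enumerated representation system is a pair $(D,\mathcal F)$, $D$ a set and $\mathcal F$ a family of partial functions $\mathbf 2^*\to D$, with: (i) $D=\bigcup_{F\in\mathcal F}Range(F)$; (ii) $F\circ\varphi\in\mathcal F$ for all $F\in\mathcal F$ and total recursive $\varphi:\mathbf 2^*\to\mathbf 2^*$; (iii) there are $U\in\mathcal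 F$ (called universal) and a total recursive $comp_U:\mathbf 2^*\times\mathbf 2^*\to\mathbf 2^*$ with $\forall F\in\mathcal F\ \exists e\ \forall p\ F(p)=U(comp_U(e,p))$. $U$ is good if moreover for every $e$ there is $c_e$ with $|comp_U(e,p)|\le|p|+c_e$ for all $p$. Every such system has a good universal function, and its Kolmogorov complexity is $K^D_{\mathcal F}(x)=\min\{|p|:U(p)=x\}$ for a fixed good universal $U$ (well-defined up to an additive constant). All families below form such systems. $\Delta$ operation. For a family $\mathcal F$ of partial functions $\mathbf 2^*\to\mathbb N$, $\Delta\mathcal F$ is the family of partial functions $p\mapsto F_1(p)-F_2(p)$ from $\mathbf 2^*$ to $\mathbb Z$, $F_1,F_2\in\mathcal F$ (defined iff both terms are). Cardinal and index. Let $(W^{\mathbb N}_e)_{e\in\mathbf 2^*}$, $(W^{\mathbb N^2}_e)_{e\in\mathbf 2^*}$ be acceptable enumerations (domains of the functions in a standard, i.e. partial recursive with s-m-n property, enumeration of partial recursive functions) of the r.e. subsets of $\mathbb N$ and of $\mathbb N^2$. $card(Y)$ is the number of elements of $Y\subseteq\mathbb N$ if $Y$ is finite, undefined otherwise. $index(\rho)$ is the number of equivalence classes if $\rho\subseteq\mathbb N^2$ is an equivalence relation on some subset of $\mathbb N$ with finitely many classes, undefined otherwise. $K^{\mathbb N}_{card}$ (resp. $K^{\mathbb N}_{index}$) is the Kolmogorov complexity of the family of all $p\mapsto card(W^{\mathbb N}_{\varphi(p)})$ (resp. $p\mapsto index(W^{\mathbb N^2}_{\varphi(p)})$), $\varphi:\mathbf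 2^*\to\mathbf 2^*$ total recursive. $K^{\mathbb Z}_{\Delta card}$, $K^{\mathbb Z}_{\Delta index}:\mathbb Z\to\mathbb N$ are the Kolmogorov complexities of the images of these families under $\Delta$. Church. $\mathbb N\to\mathbb N$ denotes the set of partial functions, $Fin(\mathbb N\to\mathbb N)$ those with finite domain. An r.e. relation $R\subseteq Fin(\mathbb N\to\mathbb N)\times\mathbf 2^*\times\mathbb N\times\mathbb N$ is functional if $y=y'$ whenever $(\alpha,p,x,y),(\beta,p,x,y')\in R$ and $\alpha\cup\beta$ is a function. The associated effectively continuous functional $\Phi_R:\mathbf 2^*\to((\mathbb N\to\mathbb N)\to(\mathbb N\to\mathbb N))$ is given by: $\Phi_R(p)(f)(x)=y$ iff $(u,p,x,y)\in R$ for some finite $u\subseteq f$. Iterates: $f^{(0)}=Id$, $f^{(n+1)}=f^{(n)}\circ f$. $Church^{\mathbb N}(\Psi)=n$ if $\Psi(f)=f^{(n)}$ for all partial $f:\mathbb N\to\mathbb N$, undefined if there is no such $n$. $K^{\mathbb N}_{Church}$ is the Kolmogorov complexity of the family of all $p\mapsto Church^{\mathbb N}(\Phi(p))$, $\Phi$ effectively continuous, and $K^{\mathbb Z}_{\Delta Church}$ that of the image of this family under $\Delta$. $K^{\mathbb Z}_{Church}$ is obtained similarly with injective partial functions: finite functions $\alpha,\beta$ and arguments $f$ range over injective partial functions $\mathbb N\to\mathbb N$ only, functionality of $R$ is required only when $\alpha\cup\beta$ is an injective function, and $Church^{\mathbb Z}(\Psi)=z\in\mathbb Z$ if for all injective partial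 $f$, $\Psi(f)=f^{(z)}$ when $z\ge0$, $\Psi(f)=(f^{-1})^{(-z)}$ when $z<0$ (undefined if there is no such $z$). *)

(* Defs.v *)
From mathcomp Require Import all_boot all_algebra finmap.
From mathcomp Require Import boolp classical_sets functions cardinality.

Set Implicit Arguments.
Unset Strict Implicit.
Unset Printing Implicit Defensive.

Local Open Scope nat_scope.
Local Open Scope classical_set_scope.

(* A partial function A -> B is a total function A -> option B, where None
   means "undefined".  Classical choice is available, so no decidability of the
   domain is implied, and [=] on values is equality of partial values. *)

Definition the (T : choiceType) (P : set T) : option T :=
  xget None [set Some x | x in P].

Definition domain (A B : Type) (f : A -> option B) : set A :=
  [set x | exists y, f x = Some y].

Definition word : Type := seq bool.

(* The bijection (x, y) |-> 2 ^ x * (2 y + 1) - 1 from nat * nat to nat. *)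
Definition npair (x y : nat) : nat := (2 ^ x * y.*2.+1).-1.
Definition nleft (z : nat) : nat := logn 2 z.+1.
Definition nright (z : nat) : nat := (z.+1 %/ 2 ^ nleft z)./2.

Lemma npairS (x y : nat) : (npair x y).+1 = 2 ^ x * y.*2.+1.
Proof. by rewrite prednK // muln_gt0 expn_gt0. Qed.

Lemma npairKl (x y : nat) : nleft (npair x y) = x.
Proof.
rewrite /nleft npairS lognM ?expn_gt0 // pfactorK //.
by rewrite lognE dvdn2 /= odd_double addn0.
Qed.

Lemma npairKr (x y : nat) : nright (npair x y) = y.
Proof.
by rewrite /nright npairKl npairS mulKn ?expn_gt0 //= uphalf_double.
Qed.

Lemma npair_surj (z : nat) : npair (nleft z) (nright z) = z.
Proof.
apply: succn_inj; rewrite npairS /nright /nleft.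
have [|m cm e] := @pfactor_coprime 2 z.+1 isT; first by [].
rewrite {2}e mulnK ?expn_gt0 // [RHS]e mulnC; congr (_ * _).
move: cm; rewrite coprime2n => om.
by rewrite -[RHS]odd_double_half om.
Qed.

(* The recursive functions in one variable, with arguments of higher arity
   coded by npair. *)
Inductive recfun : Type :=
| RZero
| RSucc
| RLeft
| RRight
| RPair of recfun & recfun
| RComp of recfun & recfun
| RPrec of recfun & recfun
| RMu of recfun.

Fixpoint sem (c : recfun) : nat -> option nat :=
  match c with
  | RZero => fun _ => Some 0
  | RSucc => fun x => Some x.+1
  | RLeft => fun x => Some (nleft x)
  | RRight => fun x => Some (nright x)
  | RPair f g => fun x =>
      obind (fun a => omap (fun b => npair a b) (sem g x)) (sem f x)
  | RComp f g => fun x => obind (sem f) (sem g x)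
  | RPrec f g => fun x =>
      (fix rec (n : nat) : option nat :=
         if n is k.+1 then
           obind (fun r => sem g (npair (nleft x) (npair k r))) (rec k)
         else sem f (nleft x)) (nright x)
  | RMu f => fun x =>
      the [set n | sem f (npair x n) = Some 0 /\
             forall k, k < n -> exists m, sem f (npair x k) = Some m.+1]
  end.

(* Data are coded by choice.pickle (finmap shadows the short name); on the types
   built from nat, bool, products and sequences (the only ones used below) it is
   the following explicit effective injection, where CodeSeq.code is a bijection
   from seq nat to nat. *)
Lemma pickle_nat (n : nat) : choice.pickle n = n.
Proof. by []. Qed.

Lemma pickle_bool (b : bool) : choice.pickle b = b :> nat.
Proof. by []. Qed.

Lemma pickle_prod (A B : countType) (a : A) (b : B) :
  choice.pickle (a, b) = CodeSeq.code [:: choice.pickle a; choice.pickle b].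
Proof. by []. Qed.

Lemma pickle_list (A : countType) (s : seq A) :
  choice.pickle s = CodeSeq.code [seq choice.pickle a | a <- s].
Proof. by []. Qed.

Lemma pickle_word (p : word) :
  choice.pickle p = CodeSeq.code [seq nat_of_bool b | b <- p].
Proof. by []. Qed.

Lemma code_cons (n : nat) (s : seq nat) :
  CodeSeq.code (n :: s) = (npair n (CodeSeq.code s)).+1.
Proof. by rewrite npairS. Qed.

Definition partial_recursive (A B : countType) (f : A -> option B) : Prop :=
  exists c, forall a, sem c (choice.pickle a) = omap choice.pickle (f a).

Definition total_recursive (A B : countType) (f : A -> B) : Prop :=
  partial_recursive (fun a => Some (f a)).

Definition recursively_enumerable (A : countType) (X : set A) : Prop :=
  exists2 f : A -> option nat, partial_recursive f & domain f = X.

(* The last clause is the s-m-n property, in its parametrization form. *)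
Definition acceptable (A : countType) (phi : word -> A -> option nat) : Prop :=
  [/\ forall f : A -> option nat,
        partial_recursive f <-> exists e, phi e = f,
      partial_recursive (fun ea : word * A => phi ea.1 ea.2) &
      forall psi : word * A -> option nat, partial_recursive psi ->
        exists2 s : word -> word, total_recursive s &
          forall p a, phi (s p) a = psi (p, a)].

Definition good_universal (D : Type) (F : set (word -> option D))
    (U : word -> option D) : Prop :=
  F U /\
  exists comp : word * word -> word,
    [/\ total_recursive comp,
        forall G, F G -> exists e, forall p, G p = U (comp (e, p)) &
        forall e, exists c, forall p, size (comp (e, p)) <= size p + c].

(* K is the complexity for some choice of a good universal U; any two such K are
   equal up to an additive constant. *)
Definition complexity (D : Type) (F : set (word -> option D))
    (K : D -> nat) : Prop :=
  exists2 U, good_universal F U &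
    forall x, (exists2 p, U p = Some x & size p = K x) /\
              (forall p, U p = Some x -> K x <= size p).

Definition le_ct (D : Type) (f g : D -> nat) : Prop :=
  exists c, forall x, f x <= g x + c.

Definition eq_ct (D : Type) (f g : D -> nat) : Prop :=
  le_ct f g /\ le_ct g f.

Definition gt_ct (D : Type) (g f : D -> nat) : Prop :=
  le_ct f g /\ ~ le_ct g f.

Definition log2 (n : nat) : nat := trunc_log 2 n.

Definition restrict_nat (K : int -> nat) : nat -> nat := fun n => K n%:Z%R.

Definition Delta (F : set (word -> option nat)) : set (word -> option int) :=
  [set (fun p => obind (fun m => omap (fun n => m%:Z - n%:Z)%R (F2 p)) (F1 p))
  | F1 in F & F2 in F].

Definition cardinal (Y : set nat) : option nat :=
  the [set n | (Y #= `I_n)%card].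

Definition cardinal_family (phi : word -> nat -> option nat)
    : set (word -> option nat) :=
  [set (fun p => cardinal (domain (phi (h p))))
  | h in [set h : word -> word | total_recursive h]].

Definition equivalence_on (A : set nat) (rho : set (nat * nat)) : Prop :=
  [/\ rho `<=` A `*` A,
      forall x, A x -> rho (x, x),
      forall x y, rho (x, y) -> rho (y, x) &
      forall x y z, rho (x, y) -> rho (y, z) -> rho (x, z)].

Definition classes (A : set nat) (rho : set (nat * nat)) : set (set nat) :=
  [set [set y | rho (x, y)] | x in A].

Definition eqv_index (rho : set (nat * nat)) : option nat :=
  the [set n | exists2 A, equivalence_on A rho & (classes A rho #= `I_n)%card].

Definition eqv_index_family (phi : word -> nat * nat -> option nat)
    : set (word -> option nat) :=
  [set (fun p => eqv_index (domain (phi (h p))))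
  | h in [set h : word -> word | total_recursive h]].

Definition pfun : Type := nat -> option nat.

Definition graph (f : pfun) : set (nat * nat) :=
  [set xy | f xy.1 = Some xy.2].

Definition is_function (G : set (nat * nat)) : Prop :=
  forall x y y', G (x, y) -> G (x, y') -> y = y'.

Definition is_injective_function (G : set (nat * nat)) : Prop :=
  is_function G /\ forall x x' y, G (x, y) -> G (x', y) -> x = x'.

Definition injective_pfun (f : pfun) : Prop := is_injective_function (graph f).

Definition finpfun : Type := {fmap nat -> nat}.

Definition fgraph (u : finpfun) : set (nat * nat) :=
  graph (fun x => u.[? x]%fmap).

Definition finpfun_relation : Type := set (finpfun * word * nat * nat).

(* A finite function is coded by any list of the elements of its graph. *)
Definition re_relation (R : finpfun_relation) : Prop :=
  recursively_enumerable
    [set t : seq (nat * nat) * word * nat * nat |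
      let: (s, p, x, y) := t in
      exists2 u : finpfun, fgraph u = [set` s] & R (u, p, x, y)].

(* At most one y qualifies if R is functional (for injective functionality: if
   moreover f is injective). *)
Definition functional_of (R : finpfun_relation) (p : word) (f : pfun) : pfun :=
  fun x => the [set y | exists2 u, fgraph u `<=` graph f & R (u, p, x, y)].

Definition functional_relation (R : finpfun_relation) : Prop :=
  forall u v p x y y', R (u, p, x, y) -> R (v, p, x, y') ->
    is_function (fgraph u `|` fgraph v) -> y = y'.

Fixpoint iter_pfun (n : nat) (f : pfun) : pfun :=
  if n is m.+1 then fun x => obind (iter_pfun m f) (f x) else fun x => Some x.

Definition Church_nat (Psi : pfun -> pfun) : option nat :=
  the [set n | forall f, Psi f = iter_pfun n f].

Definition Church_nat_family : set (word -> option nat) :=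
  [set (fun p => Church_nat (functional_of R p))
  | R in [set R | re_relation R /\ functional_relation R]].

Definition injective_relation (R : finpfun_relation) : Prop :=
  forall u p x y, R (u, p, x, y) -> is_injective_function (fgraph u).

Definition injective_functional (R : finpfun_relation) : Prop :=
  forall u v p x y y', R (u, p, x, y) -> R (v, p, x, y') ->
    is_injective_function (fgraph u `|` fgraph v) -> y = y'.

Definition inv_pfun (f : pfun) : pfun := fun y => the [set x | f x = Some y].

Definition iterz_pfun (z : int) (f : pfun) : pfun :=
  match z with
  | Posz n => iter_pfun n f
  | Negz n => iter_pfun n.+1 (inv_pfun f)
  end.

Definition Church_int (Psi : pfun -> pfun) : option int :=
  the [set z | forall f, injective_pfun f -> Psi f = iterz_pfun z f].

Definition Church_int_family : set (word -> option int) :=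
  [set (fun p => Church_int (functional_of R p))
  | R in [set R | [/\ re_relation R, injective_relation R &
                      injective_functional R]]].

(* Main.v *)
(* Iterators are exactly the partial recursive functions: the iterate n is found
   by applying the functional to the successor function at 0, and conversely the
   n-th iterate of f depends on finitely many values of f. So the three Church
   complexities are all the plain complexity, and 2 ^ n separates it from log.

   Beyond that, cardinals of r.e. sets are the suprema of computable sequences,
   their differences are the limits of computable sequences, and indices of r.e.
   equivalence relations and their differences are the same two notions relative
   to the halting problem. A strict inequality is witnessed by a number x_i
   described by about log i bits on the smaller side, and by no word shorter than
   i on the larger side. When the smaller side is made of suprema, x_i exceeds all
   the numbers described by the short words. When it is made of differences, x_i
   is the least number not described by a short word, written as the difference of
   N.+1 * S + x_i and N.+1 * S; here S is the sum of the truncations at N of the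
   suprema given by the short words, and as S grows faster than x_i can fall, both
   terms are suprema. *)
Require Import Defs.
From mathcomp Require Import all_boot all_algebra finmap.
From mathcomp Require Import boolp classical_sets functions cardinality.
From mathcomp Require Import zify.

Set Implicit Arguments.
Unset Strict Implicit.
Unset Printing Implicit Defensive.

Local Open Scope nat_scope.
Local Open Scope classical_set_scope.
Local Open Scope card_scope.

(** * Total computable functions *)

Definition computable (f : nat -> nat) : Prop :=
  exists c, forall x, sem c x = Some (f x).

Definition computable2 (f : nat -> nat -> nat) : Prop :=
  computable (fun z => f (nleft z) (nright z)).

Definition computable3 (f : nat -> nat -> nat -> nat) : Prop :=
  computable (fun z => f (nleft z) (nleft (nright z)) (nright (nright z))).

Definition computable4 (f : nat -> nat -> nat -> nat -> nat) : Prop :=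
  computable (fun z => f (nleft z) (nleft (nright z))
    (nleft (nright (nright z))) (nright (nright (nright z)))).

Lemma eq_computable f g : f =1 g -> computable f -> computable g.
Proof. by move=> e [c h]; exists c => x; rewrite h e. Qed.

Lemma comp_left : computable nleft.
Proof. by exists RLeft. Qed.

Lemma comp_right : computable nright.
Proof. by exists RRight. Qed.

Lemma comp_id : computable (fun x => x).
Proof. by exists (RPair RLeft RRight) => x /=; rewrite npair_surj. Qed.

Lemma comp_comp f a :
  computable f -> computable a -> computable (fun x => f (a x)).
Proof. by move=> [c h] [d k]; exists (RComp c d) => x /=; rewrite k /= h. Qed.

Lemma comp_pair a b :
  computable a -> computable b -> computable (fun x => npair (a x) (b x)).
Proof.
by move=> [c h] [d k]; exists (RPair c d) => x /=; rewrite h k /=.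
Qed.

Lemma comp_succ a : computable a -> computable (fun x => (a x).+1).
Proof. by apply: comp_comp; exists RSucc. Qed.

Lemma comp_const n : computable (fun _ => n).
Proof. by elim: n => [|n IH]; [exists RZero | exact: comp_succ]. Qed.

Lemma comp_app2 f a b : computable2 f -> computable a -> computable b ->
  computable (fun x => f (a x) (b x)).
Proof.
move=> hf ha hb; have := comp_comp hf (comp_pair ha hb).
by apply: eq_computable => x; rewrite npairKl npairKr.
Qed.

Lemma comp_app3 f a b c :
  computable3 f -> computable a -> computable b -> computable c ->
  computable (fun x => f (a x) (b x) (c x)).
Proof.
move=> hf ha hb hc; have := comp_comp hf (comp_pair ha (comp_pair hb hc)).
by apply: eq_computable => x; rewrite !(npairKl, npairKr).
Qed.

Lemma comp_app4 f a b c d :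
  computable4 f -> computable a -> computable b -> computable c ->
  computable d -> computable (fun x => f (a x) (b x) (c x) (d x)).
Proof.
move=> hf ha hb hc hd.
have := comp_comp hf (comp_pair ha (comp_pair hb (comp_pair hc hd))).
by apply: eq_computable => x; rewrite !(npairKl, npairKr).
Qed.

(** Predecessor, conditional, arithmetic and bounded sums below are all obtained as iterations of
    this form. *)
Lemma comp_iteri b g a : computable b -> computable3 g -> computable a ->
  computable (fun x => iteri (b x) (g x) (a x)).
Proof.
move=> hb [cg hg] [ca ha].
(* [RPrec] reads the parameter on the left and the number of steps on the right of a pair; the bound
   [b x] is plugged in afterwards. *)
have hp : computable (fun z =>
    iteri (nright z) (g (nleft z)) (a (nleft z))).
  exists (RPrec ca cg) => z /=.
  elim: (nright z) => [|k IH]; first by rewrite ha.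
  by rewrite IH /= hg !(npairKl, npairKr).
have := comp_comp hp (comp_pair comp_id hb).
by apply: eq_computable => x; rewrite npairKl npairKr.
Qed.

Lemma comp_pred a : computable a -> computable (fun x => (a x).-1).
Proof.
apply: (@comp_comp predn).
(* Each step returns its own index, so [n.+1] steps end with [n], and no step leaves 0. *)
have h : computable (fun x => iteri x (fun k _ => k) 0).
  apply: comp_iteri; [exact: comp_id | | exact: comp_const].
  exact: comp_comp comp_left comp_right.
by apply: eq_computable h; case.
Qed.

Lemma comp_if b a c :
  computable (fun x => nat_of_bool (b x)) -> computable a -> computable c ->
  computable (fun x => if b x then a x else c x).
Proof.
move=> hb ha hc.
have h : computable (fun x => iteri (b x) (fun _ _ => a x) (c x)).
  by apply: comp_iteri => //; exact: comp_comp ha comp_left.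
by apply: eq_computable h => x; case: (b x).
Qed.

Lemma comp_add a b : computable a -> computable b ->
  computable (fun x => a x + b x).
Proof.
move=> ha hb.
have h : computable (fun x => iteri (b x) (fun _ r => r.+1) (a x)).
  apply: comp_iteri => //.
  by apply: comp_succ; exact: comp_comp comp_right comp_right.
apply: eq_computable h => x.
by elim: (b x) => [|n IH] /=; rewrite ?addn0 // IH addnS.
Qed.

Lemma comp_sub a b : computable a -> computable b ->
  computable (fun x => a x - b x).
Proof.
move=> ha hb.
have h : computable (fun x => iteri (b x) (fun _ r => r.-1) (a x)).
  apply: comp_iteri => //.
  by apply: comp_pred; exact: comp_comp comp_right comp_right.
apply: eq_computable h => x.
by elim: (b x) => [|n IH] /=; rewrite ?subn0 // IH subnS.
Qed.

Lemma comp_mul a b : computable a -> computable b ->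
  computable (fun x => a x * b x).
Proof.
move=> ha hb.
have h : computable (fun x => iteri (b x) (fun _ r => r + a x) 0).
  apply: comp_iteri => //; last exact: comp_const.
  by apply: comp_add; [exact: comp_comp comp_right comp_right |
    exact: comp_comp ha comp_left].
apply: eq_computable h => x.
by elim: (b x) => [|n IH] /=; rewrite ?muln0 // IH mulnSr.
Qed.

Lemma comp_exp a b : computable a -> computable b ->
  computable (fun x => a x ^ b x).
Proof.
move=> ha hb.
have h : computable (fun x => iteri (b x) (fun _ r => r * a x) 1).
  apply: comp_iteri => //; last exact: comp_const.
  by apply: comp_mul; [exact: comp_comp comp_right comp_right |
    exact: comp_comp ha comp_left].
apply: eq_computable h => x.
by elim: (b x) => [|n IH] //=; rewrite IH expnSr.
Qed.

Lemma comp_sum b F : computable b -> computable2 F ->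
  computable (fun x => \sum_(0 <= k < b x) F x k).
Proof.
move=> hb hF.
have h : computable (fun x => iteri (b x) (fun k r => r + F x k) 0).
  apply: comp_iteri => //; last exact: comp_const.
  apply: comp_add; first exact: comp_comp comp_right comp_right.
  by apply: (comp_app2 hF); [exact: comp_left |
    exact: comp_comp comp_left comp_right].
apply: eq_computable h => x.
by elim: (b x) => [|n IH]; rewrite ?big_nil // big_nat_recr //= IH.
Qed.

Lemma comp_not P : computable (fun x => nat_of_bool (P x)) ->
  computable (fun x => nat_of_bool (~~ P x)).
Proof.
move=> h; have := comp_sub (comp_const 1) h.
by apply: eq_computable => x; case: (P x).
Qed.

Lemma comp_leq a b : computable a -> computable b ->
  computable (fun x => nat_of_bool (a x <= b x)).
Proof.
move=> ha hb; have := comp_sub (comp_const 1) (comp_sub ha hb).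
by apply: eq_computable => x; rewrite -subn_eq0; case: (a x - b x).
Qed.

Lemma comp_and P Q : computable (fun x => nat_of_bool (P x)) ->
  computable (fun x => nat_of_bool (Q x)) ->
  computable (fun x => nat_of_bool (P x && Q x)).
Proof.
by move=> h k; have := comp_mul h k; apply: eq_computable => x; rewrite mulnb.
Qed.

Lemma comp_or P Q : computable (fun x => nat_of_bool (P x)) ->
  computable (fun x => nat_of_bool (Q x)) ->
  computable (fun x => nat_of_bool (P x || Q x)).
Proof.
move=> h k; have := comp_not (comp_and (comp_not h) (comp_not k)).
by apply: eq_computable => x; rewrite negb_and !negbK.
Qed.

Lemma comp_imply P Q : computable (fun x => nat_of_bool (P x)) ->
  computable (fun x => nat_of_bool (Q x)) ->
  computable (fun x => nat_of_bool (P x ==> Q x)).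
Proof.
move=> h k; have := comp_or (comp_not h) k.
by apply: eq_computable => x; rewrite implybE.
Qed.

Lemma comp_eq a b : computable a -> computable b ->
  computable (fun x => nat_of_bool (a x == b x)).
Proof.
move=> ha hb; have := comp_and (comp_leq ha hb) (comp_leq hb ha).
by apply: eq_computable => x; rewrite eqn_leq.
Qed.

(** Bounded quantifiers with a head symbol of their own, which [comp_step] can recognize in a
    goal. *)
Definition ball (n : nat) (P : nat -> bool) : bool := all P (iota 0 n).
Definition bex (n : nat) (P : nat -> bool) : bool := has P (iota 0 n).

Lemma ballP n (P : nat -> bool) :
  reflect (forall k, k < n -> P k) (ball n P).
Proof.
by apply: (iffP allP) => h k; have := h k; rewrite mem_iota.
Qed.

Lemma bexP n (P : nat -> bool) :
  reflect (exists2 k, k < n & P k) (bex n P).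
Proof.
by apply: (iffP hasP) => -[k h1 h2]; exists k => //; move: h1;
  rewrite mem_iota.
Qed.

Lemma comp_bex b (P : nat -> nat -> bool) : computable b ->
  computable2 (fun x k => nat_of_bool (P x k)) ->
  computable (fun x => nat_of_bool (bex (b x) (P x))).
Proof.
move=> hb hP; have := comp_leq (comp_const 1) (comp_sum hb hP).
apply: eq_computable => x; congr nat_of_bool.
rewrite lt0n sum_nat_seq_neq0 /bex /index_iota subn0.
by apply: eq_has => k /=; case: (P x k).
Qed.

Lemma comp_ball b (P : nat -> nat -> bool) : computable b ->
  computable2 (fun x k => nat_of_bool (P x k)) ->
  computable (fun x => nat_of_bool (ball (b x) (P x))).
Proof.
move=> hb hP; have := comp_not (@comp_bex b (fun x k => ~~ P x k) hb (comp_not hP)).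
by apply: eq_computable => x; rewrite /bex /ball has_predC negbK.
Qed.

(** Follows the syntax of the body of a function. Defined functions are handled through hypotheses,
    so their computability is put in the context beforehand. *)
Ltac comp_step :=
  lazymatch goal with
  | |- computable2 _ => unfold computable2
  | |- computable3 _ => unfold computable3
  | |- computable4 _ => unfold computable4
  | |- computable (fun x => x) => exact comp_id
  | |- computable (fun _ => ?c) => exact (comp_const c)
  | |- computable nleft => exact comp_left
  | |- computable nright => exact comp_right
  | |- computable predn => exact (comp_pred comp_id)
  | |- computable S => exact (comp_succ comp_id)
  | |- computable (fun x => nleft _) => apply (comp_comp comp_left)
  | |- computable (fun x => nright _) => apply (comp_comp comp_right)
  | |- computable (fun x => S _) => apply comp_succ
  | |- computable (fun x => predn _) => apply comp_pred
  | |- computable (fun x => npair _ _) => apply comp_pair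
  | |- computable (fun x => addn _ _) => apply comp_add
  | |- computable (fun x => subn _ _) => apply comp_sub
  | |- computable (fun x => muln _ _) => apply comp_mul
  | |- computable (fun x => expn _ _) => apply comp_exp
  | |- computable (fun x => if _ then _ else _) => apply comp_if
  | |- computable (fun x => iteri _ _ _) => apply comp_iteri
  | |- computable (fun x => bigop.body _ _ _) => apply comp_sum
  | |- computable (fun x => nat_of_bool (leq _ _)) => apply comp_leq
  | |- computable (fun x => nat_of_bool (eq_op _ _)) => apply comp_eq
  | |- computable (fun x => nat_of_bool (andb _ _)) => apply comp_and
  | |- computable (fun x => nat_of_bool (orb _ _)) => apply comp_or
  | |- computable (fun x => nat_of_bool (implb _ _)) => apply comp_imply
  | |- computable (fun x => nat_of_bool (negb _)) => apply comp_not
  | |- computable (fun x => nat_of_bool (ball _ _)) => apply comp_ball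
  | |- computable (fun x => nat_of_bool (bex _ _)) => apply comp_bex
  | _ => match goal with
    | H : computable ?f |- computable ?f => exact H
    | H : computable ?f |- computable (fun x => ?f _) => apply (comp_comp H)
    | H : computable (fun a => nat_of_bool (?P a)) |-
      computable (fun x => nat_of_bool (?P _)) => apply (comp_comp H)
    | H : computable2 ?f |- computable (fun x => ?f _ _) => apply (comp_app2 H)
    | H : computable2 (fun a b => nat_of_bool (?P a b)) |-
      computable (fun x => nat_of_bool (?P _ _)) => apply (comp_app2 H)
    | H : computable3 (fun a b c => nat_of_bool (?P a b c)) |-
      computable (fun x => nat_of_bool (?P _ _ _)) => apply (comp_app3 H)
    | H : computable3 ?f |- computable (fun x => ?f _ _ _) =>
      apply (comp_app3 H)
    | H : computable4 (fun a b c d => nat_of_bool (?P a b c d)) |-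
      computable (fun x => nat_of_bool (?P _ _ _ _)) => apply (comp_app4 H)
    end
  end.
Ltac comp := repeat comp_step.

(** * Sequences of numbers *)

(** By [code_cons] the code of a nonempty sequence is one more than the pair of its head and the
    code of its tail, and 0 codes the empty sequence. A step drops the head, and stays at 0 once the
    sequence is exhausted. *)
Definition tails (q k : nat) : nat := iteri k (fun _ r => nright r.-1) q.
Definition item (q k : nat) : nat := nleft (tails q k).-1.
(** A sequence is no longer than its code, so the code itself can bound the count of nonempty
    tails. *)
Definition len (q : nat) : nat := \sum_(0 <= k < q) (0 < tails q k).

Lemma nleft0 : nleft 0 = 0.
Proof. exact: (npairKl 0 0). Qed.

Lemma nright0 : nright 0 = 0.
Proof. exact: (npairKr 0 0). Qed.

Lemma tails_code s k : tails (CodeSeq.code s) k = CodeSeq.code (drop k s).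
Proof.
rewrite /tails; elim: k => [|k IH]; first by rewrite drop0.
rewrite /= {}IH -add1n -drop_drop; case: (drop k s) => [|n s'].
  exact: nright0.
by rewrite code_cons [_.-1]/= npairKr [RHS]/= drop0.
Qed.

Lemma item_code s k : item (CodeSeq.code s) k = nth 0 s k.
Proof.
rewrite /item tails_code -[k in RHS]addn0 -nth_drop.
by case: (drop k s) => [|n s']; rewrite ?nleft0 // code_cons /= npairKl.
Qed.

Lemma size_code s : size s <= CodeSeq.code s.
Proof.
elim: s => // n s IH; rewrite code_cons ltnS (leq_trans IH) // -ltnS npairS.
by rewrite (@leq_trans (CodeSeq.code s).*2.+1) //;
  rewrite ?leq_pmull ?expn_gt0 // ltnS -addnn leq_addr.
Qed.

Lemma len_code s : len (CodeSeq.code s) = size s.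
Proof.
rewrite /len (big_cat_nat (n := size s)) ?size_code //=.
rewrite [X in _ + X]big_nat_cond [X in _ + X]big1 => [|k]; last first.
  by case/andP => /andP[h _] _; rewrite tails_code drop_oversize.
rewrite addn0 big_nat_cond (eq_bigr (fun=> 1)) => [|k /andP[h _]].
  by rewrite -big_nat_cond sum_nat_const_nat subn0 muln1.
by rewrite tails_code (drop_nth 0) // code_cons.
Qed.

Lemma comp_tails : computable2 tails.
Proof. by rewrite /tails; comp. Qed.

Lemma comp_item : computable2 item.
Proof. by move: comp_tails => h; rewrite /item; comp. Qed.

Lemma comp_len : computable len.
Proof. by move: comp_tails => h; rewrite /len; comp. Qed.

(** * Partial recursive functions *)

Lemma theP (T : choiceType) (P : set T) x : the P = Some x -> P x.
Proof.
rewrite /the; case: xgetP => [o -> [y Py [<-]] [<-] //|_ //].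
Qed.

Lemma the_eq (T : choiceType) (P : set T) x :
  P x -> (forall y, P y -> y = x) -> the P = Some x.
Proof.
move=> Px u; rewrite /the; case: xgetP => [o -> [y /u -> //]|h].
by case: (h (Some x)); exists x.
Qed.

(* A stage function for f: [T x t] is y + 1 once the value y of f at x has been
   found by stage t, and 0 before. *)
Definition approximates (T : nat -> nat -> nat) (f : nat -> option nat) : Prop :=
  (forall x t t' y, T x t = y.+1 -> t <= t' -> T x t' = y.+1) /\
  (forall x y, f x = Some y <-> exists t, T x t = y.+1).

Lemma approximates_total g : approximates (fun x _ => (g x).+1)
  (fun x => Some (g x)).
Proof.
split=> // x y; split=> [[->]|[_ [->]] //].
by exists 0.
Qed.

(** Lets a stage function return a unique solution as a bounded sum; the shift by one keeps 0 for a
    solution not found yet. *)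
Lemma sum_unique t n (C : nat -> bool) :
  n < t -> C n -> (forall m, C m -> m = n) ->
  \sum_(0 <= k < t) (if C k then k.+1 else 0) = n.+1.
Proof.
move=> nt Cn u.
rewrite (bigD1_seq n) ?mem_index_iota ?iota_uniq //= Cn big1 ?addn0 // => m mn.
by case: ifP => // /u e; rewrite e eqxx in mn.
Qed.

(* The stage function of a code is built by recursion on the code, so that no
   universal machine is needed. *)
Lemma normal_form c : exists2 T, computable2 T & approximates T (sem c).
Proof.
have basic g : computable g -> exists2 T, computable2 T &
    approximates T (fun x => Some (g x)).
  move=> hg; exists (fun x _ => (g x).+1); first by comp.
  exact: approximates_total.
elim: c => [|||| f [F cF [mF sF]] g [G cG [mG sG]]
  | f [F cF [mF sF]] g [G cG [mG sG]] | f [F cF [mF sF]] g [G cG [mG sG]]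
  | f [F cF [mF sF]]].
- by apply: (basic (fun=> 0)); comp.
- by apply: (basic succn); apply: comp_succ comp_id.
- by apply: (basic nleft); comp.
- by apply: (basic nright); comp.
- exists (fun x t => if (0 < F x t) && (0 < G x t)
      then (npair (F x t).-1 (G x t).-1).+1 else 0); first by comp.
  split=> [x t t' y|x y] /=.
    case eF: (F x t) => [|a] //; case eG: (G x t) => [|b] //= ab tt'.
    by rewrite (mF _ _ _ _ eF tt') (mG _ _ _ _ eG tt').
  split=> [|[t]].
    case ef: (sem f x) => [a|] //; case eg: (sem g x) => [b|] //= -[<-].
    have [t1 h1] := (sF _ _).1 ef; have [t2 h2] := (sG _ _).1 eg.
    exists (t1 + t2).
    by rewrite (mF _ _ _ _ h1) ?leq_addr // (mG _ _ _ _ h2) ?leq_addl.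
  case eF: (F x t) => [|a] //; case eG: (G x t) => [|b] //= [<-].
  have -> : sem f x = Some a by apply/sF; exists t.
  by have -> : sem g x = Some b by apply/sG; exists t.
- exists (fun x t => if 0 < G x t then F (G x t).-1 t else 0); first by comp.
  split=> [x t t' y|x y] /=.
    case eG: (G x t) => [|b] //= h tt'.
    by rewrite (mG _ _ _ _ eG tt') /= (mF _ _ _ _ h tt').
  split=> [|[t]].
    case eg: (sem g x) => [b|] //= ef.
    have [t1 h1] := (sF _ _).1 ef; have [t2 h2] := (sG _ _).1 eg.
    exists (t1 + t2); rewrite (mG _ _ _ _ h2) ?leq_addl //=.
    by rewrite (mF _ _ _ _ h1) ?leq_addr.
  case eG: (G x t) => [|b] //= h.
  have -> /= : sem g x = Some b by apply/sG; exists t.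
  by apply/sF; exists t.
(* All the calls run with the same stage [t]; a 0 in the accumulator means that some call has not
   converged, and is passed on. *)
- exists (fun x t => iteri (nright x)
      (fun k r => if 0 < r then G (npair (nleft x) (npair k r.-1)) t else 0)
      (F (nleft x) t)); first by comp.
  split=> [x t t' y|x y] /=.
    move=> + tt'; elim: (nright x) y => [|n IH] y /=; first by move=> h; exact: mF h tt'.
    case: ifP => //; case: (iteri _ _ _) IH => // r /(_ r erefl) -> _ /= h.
    exact: mG h tt'.
  elim: (nright x) y => [|n IH] y /=; first exact: sF.
  move: IH; set o := (X in obind _ X) => IH.
  split=> [|[t]].
    case er: o => [r|] //= eg; have [t1 h1] := (IH r).1 er.
    have [t2 h2] := (sG _ _).1 eg; exists (t1 + t2).
    suff -> /= : iteri n (fun k r => if 0 < r then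
      G (npair (nleft x) (npair k r.-1)) (t1 + t2) else 0)
      (F (nleft x) (t1 + t2)) = r.+1 by rewrite (mG _ _ _ _ h2) ?leq_addl.
    move: h1 {IH er eg h2 o}; elim: n r => [|n IH] r /=.
      by move=> h; rewrite (mF _ _ _ _ h) ?leq_addr.
    case: ifP => //; case: (iteri _ _ (F _ t1)) IH => // r' /(_ r' erefl) -> _ /=.
    by move=> h; rewrite (mG _ _ _ _ h) ?leq_addr.
  case: ifP => //; case er: (iteri _ _ _) => [|r] // _ /= h.
  have -> /= : o = Some r by apply/IH; exists t.
  by apply/sG; exists t.
(* In stage functions 1 stands for the value 0, and anything above 1 for a positive value. *)
- pose C x t n := (F (npair x n) t == 1) &&
    ball n (fun k => 1 < F (npair x k) t).
  have Cu x t n m : C x t n -> C x t m -> m = n.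
    move=> /andP[/eqP n1 /ballP nk] /andP[/eqP m1 /ballP mk].
    case: (ltngtP m n) => // h; first by have := nk _ h; rewrite m1.
    by have := mk _ h; rewrite n1.
  have Cm x t t' n : C x t n -> t <= t' -> C x t' n.
    move=> /andP[/eqP n1 /ballP nk] tt'; apply/andP; split.
      by rewrite (mF _ _ _ _ n1 tt').
    apply/ballP => k /nk; case e: (F _ t) => [//|a].
    by rewrite (mF _ _ _ _ e tt').
  pose T x t := \sum_(0 <= n < t) (if C x t n then n.+1 else 0).
  have TC x t n : T x t = n.+1 <-> n < t /\ C x t n.
    split=> [|[nt Cn]]; last by apply: sum_unique => // m; apply: Cu.
    have [[m mt Cm1]|no] := pselect (exists2 m, m < t & C x t m).
      rewrite /T (sum_unique mt Cm1) => [[<-] //|k]; exact: Cu.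
    rewrite /T big_nat_cond big1 // => m /andP[/andP[_ mt] _].
    by case: ifP => // h; case: no; exists m.
  exists T; first by rewrite /T /C; comp.
  split=> [x t t' n /TC[nt h] tt'|x n] /=.
    by apply/TC; split; [exact: leq_trans tt' | exact: Cm tt'].
  have Csem t m : C x t m -> sem f (npair x m) = Some 0 /\
      (forall k, k < m -> exists a, sem f (npair x k) = Some a.+1).
    move=> /andP[/eqP m1 /ballP mk]; split; first by apply/sF; exists t.
    move=> k /mk; case e: (F _ t) => [|[|a]] // _.
    by exists a; apply/sF; exists t.
  split=> [/theP[/sF[t h] hk]|[t /TC[nt /Csem[h1 h2]]]].
    have [t' tn tk] : exists2 t', t <= t' & forall k, k < n -> 1 < F (npair x k) t'.
      elim: n hk {h} => [|n IH] hk; first by exists t.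
      have [|t1 tt1 h1] := IH; first by move=> k kn; apply: hk; exact: ltnW.
      have [a /sF[t2 h2]] := hk n (ltnSn n); exists (t1 + t2).
        by rewrite (leq_trans tt1) ?leq_addr.
      move=> k; rewrite ltnS leq_eqVlt => /predU1P[->|/h1].
        by rewrite (mF _ _ _ _ h2) ?leq_addl.
      case e: (F _ t1) => [//|b].
      by rewrite (mF _ _ _ _ e) ?leq_addr.
    (* The stage must exceed [n] too, since [T] only looks for roots below the stage. *)
    exists (t' + n).+1; apply/TC; split; first by rewrite ltnS leq_addl.
    apply/andP; split.
      by rewrite (mF _ _ _ _ h) // (leq_trans tn) // ltnW // ltnS leq_addr.
    apply/ballP => k /tk; case e: (F _ t') => [//|b].
    by rewrite (mF _ _ _ _ e) // ltnW // ltnS leq_addr.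
  apply: the_eq => [|m [m1 mk]]; first by split.
  case: (ltngtP m n) => // h; first by have [a] := h2 _ h; rewrite m1.
  by have [a] := mk _ h; rewrite h1.
Qed.

(** As [D] is total, minimization never meets an undefined value and halts exactly when there is a
    witness. It looks for zeros, whence the negation of [D]. *)
Lemma search_code (D : nat -> nat -> bool) : computable2 D ->
  exists c, forall q,
    (forall z, sem c q = Some z -> D q z) /\
    ((exists z, D q z) <-> exists z, sem c q = Some z).
Proof.
move=> hD; have [d hd] : computable2 (fun q z => ~~ D q z) by comp.
have dE q k : sem d (npair q k) = Some (nat_of_bool (~~ D q k)).
  by rewrite hd npairKl npairKr.
exists (RMu d) => q /=; set P := (X in the X).
have PE n : P n -> D q n by case; rewrite dE => -[]; case: (D q n).
split=> [z /theP/PE //|]; split=> [ex|[z /theP/PE Dz]]; last by exists z.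
have [n Dn nmin] := ex_minnP ex.
have Pn : P n.
  split=> [|k kn]; first by rewrite dE Dn.
  rewrite dE; case Dk: (D q k); last by exists 0.
  by have := nmin _ Dk; rewrite leqNgt kn.
exists n; apply: the_eq => // m [m1 mk].
case: (ltngtP m n) => // h.
  by have [a] := Pn.2 _ h; rewrite m1.
by have [a] := mk _ h; rewrite Pn.1.
Qed.

(** * Codes of pairs, and acceptable enumerations *)

(** [choice.pickle] codes a pair as a sequence of length two, not by [npair]; this is that code in
    arithmetical form. *)
Definition kpair (a b : nat) : nat := (npair a (npair b 0).+1).+1.
Definition kfst (q : nat) : nat := nleft q.-1.
Definition ksnd (q : nat) : nat := nleft (nright q.-1).-1.

Lemma kpairKl a b : kfst (kpair a b) = a.
Proof. exact: npairKl. Qed.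

Lemma kpairKr a b : ksnd (kpair a b) = b.
Proof. by rewrite /ksnd /kpair [_.-1]/= npairKr [_.-1]/= npairKl. Qed.

Lemma kpairE a b : kpair a b = CodeSeq.code [:: a; b].
Proof. by rewrite !code_cons. Qed.

Lemma pickle_kpair (A B : countType) (a : A) (b : B) :
  choice.pickle (a, b) = kpair (choice.pickle a) (choice.pickle b).
Proof. by rewrite kpairE. Qed.

Lemma comp_kpair : computable2 kpair.
Proof. by rewrite /kpair; comp. Qed.

Lemma comp_kfst : computable kfst.
Proof. by rewrite /kfst; comp. Qed.

Lemma comp_ksnd : computable ksnd.
Proof. by rewrite /ksnd; comp. Qed.

(** The search for [z] is partial recursive in [p] and [a] jointly, and the s-m-n property turns [p]
    into an index. *)
Lemma acceptable_index (A : countType) (phi : word -> A -> option nat)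
    (D : nat -> nat -> nat -> bool) :
  acceptable phi -> computable3 D ->
  exists2 h : word -> word, total_recursive h &
    forall p, domain (phi (h p)) =
      [set a | exists z, D (choice.pickle p) (choice.pickle a) z].
Proof.
move=> [_ _ smn] hD.
have [|c hc] := @search_code (fun q z => D (kfst q) (ksnd q) z).
  by move: comp_kfst comp_ksnd => h1 h2; comp.
have [|h hrec hh] := smn (fun pa : word * A => sem c (choice.pickle pa)).
  by exists c => pa; case: (sem c _).
exists h => // p; apply/seteqP; split=> a.
  rewrite /domain /= hh => /(hc _).2; rewrite pickle_kpair.
  by case=> z; rewrite kpairKl kpairKr; exists z.
by move=> [z Dz]; rewrite /domain /= hh; apply/(hc _).2;
  exists z; rewrite pickle_kpair kpairKl kpairKr.
Qed.

(** Universality of [phi] and a code of [h] give one code for the whole family [phi (h p) a]; its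
    stage function tells by which stage [a] has been enumerated. *)
Lemma acceptable_stages (A : countType) (phi : word -> A -> option nat)
    (h : word -> word) :
  acceptable phi -> total_recursive h ->
  exists2 W : nat -> nat -> nat -> bool, computable3 W &
    (forall p a t t', W p a t -> t <= t' -> W p a t') /\
    (forall (p : word) (a : A), domain (phi (h p)) a <->
       exists t, W (choice.pickle p) (choice.pickle a) t).
Proof.
move=> [_ [c hc] _] [d hd].
have [ck hk] := comp_kpair.
pose e := RComp c (RComp ck (RPair (RComp d RLeft) RRight)).
have [T hT [mT sT]] := normal_form e.
exists (fun p a t => 0 < T (npair p a) t); first by comp.
split=> [p a t t'|p a].
  by case eT: (T _ t) => [//|y] _ tt'; rewrite (mT _ _ _ _ eT tt').
have e1 : sem e (npair (choice.pickle p) (choice.pickle a)) = phi (h p) a.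
  rewrite /= npairKl npairKr hd /= hk npairKl npairKr /= -pickle_kpair hc /=.
  by case: (phi _ _).
rewrite /domain /= -e1; split=> [[y /sT[t ht]]|[t]].
  by exists t; rewrite ht.
by case ht: (T _ t) => [//|y] _; exists y; apply/sT; exists t.
Qed.

(** * Finite cardinals and indices *)

Lemma card_uniq_seq (T : choiceType) (X : set T) n :
  X #= `I_n <-> exists s : seq T, [/\ uniq s, size s = n & X = [set` s]].
Proof.
split=> [h|[s [us <- ->]]].
  have /finite_fsetP[F eX] : finite_set X by apply/finite_setP; exists n.
  exists F; split; [exact: fset_uniq | | exact: eX].
  by move: h; rewrite eX => /card_eq_fsetP.
have -> : [set` s] = [set` [fset x in s]%fset].
  by apply/seteqP; split=> x /=; rewrite in_fset.
by apply/card_eq_fsetP; rewrite card_fseq undup_id.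
Qed.

Lemma card_size_le (T : choiceType) (X : set T) n (s : seq T) :
  X #= `I_n -> uniq s -> (forall x, x \in s -> X x) -> size s <= n.
Proof.
move=> /card_uniq_seq[s' [us' <- ->]] us h.
by apply: uniq_leq_size => // x /h.
Qed.

Lemma cardinalP (Y : set nat) n : cardinal Y = Some n <-> Y #= `I_n.
Proof.
split=> [/theP//|h]; apply: the_eq => // m hm.
by apply/card_eq_II; exact: card_eq_trans (card_esym hm) h.
Qed.

Lemma classes_refl A rho x y : equivalence_on A rho -> A x ->
  ([set z | rho (x, z)] = [set z | rho (y, z)]) <-> rho (y, x).
Proof.
move=> [sub refl sym tr] Ax; split=> [e|yx].
  have : [set z | rho (x, z)] x by exact: refl.
  by rewrite e.
apply/seteqP; split=> z /=; first exact: tr.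
by apply: tr; exact: sym.
Qed.

Lemma eqv_indexP A rho n : equivalence_on A rho ->
  eqv_index rho = Some n <-> classes A rho #= `I_n.
Proof.
move=> eA.
(* The set on which [rho] is an equivalence is recovered from [rho] itself, so the index does not
   depend on its choice. *)
have dom B : equivalence_on B rho -> B = [set x | rho (x, x)].
  move=> [sub refl _ _]; apply/seteqP; split=> x; first exact: refl.
  by move=> /sub[].
split=> [/theP[B eB]|h]; first by rewrite (dom _ eA) -(dom _ eB).
apply: the_eq => [|m [B eB]]; first by exists A.
rewrite (dom _ eB) -(dom _ eA) => hm.
by apply/card_eq_II; exact: card_eq_trans (card_esym hm) h.
Qed.

Lemma eqv_index0 : eqv_index set0 = Some 0.
Proof.
have e0 : equivalence_on set0 set0 by split.
apply/(eqv_indexP _ e0).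
by rewrite /classes image_set0 II0.
Qed.

(** Enumerating more pairs merges classes, so an r.e. relation can count a co-r.e. set: all dead
    points form one class, the extra one, and every other point is alone in its class. *)
Lemma eqv_index_collapse (dead : set nat) n : dead !=set0 ->
  ~` dead #= `I_n ->
  eqv_index [set ab | ab.1 = ab.2 \/ dead ab.1 /\ dead ab.2] = Some n.+1.
Proof.
move=> [d0 d0P] hn; set rho := [set ab | _].
have eT : equivalence_on setT rho.
  split=> // [x _|x y [e|[]]|x y z]; first by left.
  - by left.
  - by right.
  by rewrite /rho /=; case=> [->//|[dx dy]] [<-|[_ dz]]; right.
apply/(eqv_indexP _ eT)/eq_cardSP; exists [set z | rho (d0, z)].
  by exists d0.
have -> : classes setT rho `\ [set z | rho (d0, z)] =
    (fun x => [set z | rho (x, z)]) @` (~` dead).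
  apply/seteqP; split=> [X [[x _ <-] /= ne]|X [x nx <-]].
    exists x => // dx; apply: ne; apply/(classes_refl _ eT) => //.
    by right.
  split=> [|/= /(classes_refl d0 eT)]; first by exists x.
  by move=> /(_ I)[/= e|[_]//]; apply: nx; rewrite -e.
apply: card_eq_trans hn; apply: inj_card_eq => x y.
by rewrite !inE => nx ny /(classes_refl y eT I)[//|[/ny]].
Qed.

Lemma card_index (phi : word -> nat -> option nat) (D : nat -> nat -> nat -> bool) :
  acceptable phi -> computable3 D ->
  exists2 h : word -> word, total_recursive h & forall p n,
    [set x | exists z, D (choice.pickle p) x z] #= `I_n ->
    cardinal (domain (phi (h p))) = Some n.
Proof.
move=> ha hD; have [h hr hE] := acceptable_index ha hD.
by exists h => // p n hn; apply/cardinalP; rewrite hE.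
Qed.

(* A Sigma_2 set has as many elements as the set of its points paired with their
   least witness z and the least stage u at which all smaller witnesses are
   refuted. This set is Pi_1, and [eqv_index_collapse] applies to its
   complement. *)
Lemma eqv_index_index (phi : word -> nat * nat -> option nat)
    (D : nat -> nat -> nat -> nat -> bool) :
  acceptable phi -> computable4 D ->
  exists2 h : word -> word, total_recursive h & forall p n,
    [set x | exists z, forall t, D (choice.pickle p) x z t] #= `I_n ->
    eqv_index (domain (phi (h p))) = Some n.+1.
Proof.
move=> ha hD.
pose ready p x z u := ball z (fun z' => bex u.+1 (fun t => ~~ D p x z' t)).
pose first p x z u := ready p x z u && ((u == 0) || ~~ ready p x z u.-1).
(* Here [e] codes the triple of the point [x], the witness [z] and the stage [u]. *)
pose dies p e t := ~~ (first p (nleft e) (nleft (nright e)) (nright (nright e))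
   && D p (nleft e) (nleft (nright e)) t).
have hready : computable4 ready by rewrite /ready; comp.
have hfirst : computable4 first by rewrite /first; comp.
have hdies : computable3 dies by rewrite /dies; comp.
have [|h hr hE] := acceptable_index
    (D := fun p ab z => (kfst ab == ksnd ab) ||
      (dies p (kfst ab) (nleft z) && dies p (ksnd ab) (nright z))) ha.
  by move: comp_kfst comp_ksnd => ? ?; comp.
exists h => // p n; set q := choice.pickle p => hn.
pose dead := [set e | exists t, dies q e t].
have -> : domain (phi (h p)) =
    [set ab | ab.1 = ab.2 \/ dead ab.1 /\ dead ab.2].
  rewrite hE; apply/seteqP; split=> -[a b].
    case=> z; rewrite pickle_kpair kpairKl kpairKr => /orP[/eqP e|/andP[d1 d2]].
      by left.
    by right; split; [exists (nleft z) | exists (nright z)].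
  rewrite /mkset pickle_kpair kpairKl kpairKr.
  case=> [/= ->|[[t1 d1] [t2 d2]]]; first by exists 0; rewrite eqxx.
  by exists (npair t1 t2); rewrite npairKl npairKr d1 d2 orbT.
have alive e : (~` dead) e <-> first q (nleft e) (nleft (nright e))
    (nright (nright e)) /\ forall t, D q (nleft e) (nleft (nright e)) t.
  split=> [nd|[h1 h2] [t]]; last by rewrite /dies h1 h2.
  have nd' t : ~~ dies q e t by apply/negP => dt; apply: nd; exists t.
  split=> [|t]; first by have := nd' 0; rewrite negbK => /andP[].
  by have := nd' t; rewrite negbK => /andP[].
have readym x z u u' : ready q x z u -> u <= u' -> ready q x z u'.
  move=> /ballP h1 uu'; apply/ballP => k /h1 /bexP[t tu nD].
  by apply/bexP; exists t => //; exact: leq_trans uu'.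
have firstu x z u u' : first q x z u -> first q x z u' -> u = u'.
  have le v v' : first q x z v -> first q x z v' -> v' <= v.
    move=> /andP[r _] /andP[_ /orP[/eqP-> //|]]; apply: contraNT.
    rewrite -ltnNge => lt; apply: readym r _; lia.
  by move=> f1 f2; apply/eqP; rewrite eqn_leq !le.
have readyN x z u z' : ready q x z u -> z' < z -> ~ forall t, D q x z' t.
  by move=> /ballP h1 /h1 /bexP[t _ /negP nD] /(_ t).
apply: eqv_index_collapse.
  (* Nothing lies below the witness 0, so its first ready stage is 0 and the triple with stage 1 is
     dead. *)
  exists (npair 0 (npair 0 1)), 0.
  by rewrite /dies !(npairKl, npairKr) /first /ready.
apply: card_eq_trans hn.
have -> : [set x | exists z, forall t, D q x z t] = nleft @` (~` dead).
  apply/seteqP; split=> [x exz|_ [e /alive[_ h1] <-]]; last by exists (nleft (nright e)).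
  have exz' : exists z, `[< forall t, D q x z t >].
    by have [z hz] := exz; exists z; apply/asboolP.
  have [z /asboolP hz zmin] := ex_minnP exz'.
  have exu : exists u, ready q x z u.
    have wit z' : exists u, z' < z -> ~~ D q x z' u.
      have [lt|] := boolP (z' < z); last by exists 0.
      apply: contrapT => no.
      have /asboolP/zmin : forall t, D q x z' t.
        move=> t; apply/negPn/negP => nD; apply: no; exists t => _.
        exact: nD.
      by rewrite leqNgt lt.
    have {}wit : exists u, forall z', z' < z -> exists2 t, t <= u & ~~ D q x z' t.
      elim: {1 3}z (leqnn z) => [|m IH] mz; first by exists 0.
      have [u hu] := IH (ltnW mz); have [t /(_ mz) ht] := wit m.
      exists (u + t) => z'; rewrite ltnS leq_eqVlt => /predU1P[->|/hu[t' h1 h2]].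
        by exists t; rewrite ?leq_addl.
      by exists t' => //; rewrite (leq_trans h1) ?leq_addr.
    have [u hu] := wit; exists u; apply/ballP => z' /hu[t tu nD].
    by apply/bexP; exists t.
  have [u hu umin] := ex_minnP exu.
  exists (npair x (npair z u)); last by rewrite npairKl.
  apply/alive; rewrite !(npairKl, npairKr); split=> //.
  rewrite /first hu /=; case: u hu umin => //= u _ umin.
  by apply/negP => /umin; rewrite ltnn.
(* Over a given point only one triple survives: the least witness and the first ready stage are
   unique. *)
apply: card_esym; apply: inj_card_eq => e e'.
rewrite !inE => /alive[f1 D1] /alive[f2 D2] ex.
suff [ez eu] : nleft (nright e) = nleft (nright e') /\
    nright (nright e) = nright (nright e').
  by rewrite -[e]npair_surj -[nright e]npair_surj ex ez eu !npair_surj.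
move: f1 D1 f2 D2; rewrite ex; move: (nleft e') (nleft (nright e))
  (nright (nright e)) (nleft (nright e')) (nright (nright e')).
move=> x z u z' u' f1 D1 f2 D2.
have ez : z = z'.
  have [/andP[r1 _] /andP[r2 _]] := (f1, f2).
  by case: (ltngtP z z') => // lt; [case: (readyN _ _ _ _ r2 lt) |
    case: (readyN _ _ _ _ r1 lt)].
by move: f2; rewrite -ez => f2; split=> //; exact: firstu f1 f2.
Qed.

(** * Words as numbers, and comparison of complexities *)

(* For the pickle of a word this is bijective base 2 numeration. *)
Definition numeral (q : nat) : nat := \sum_(0 <= k < len q) (item q k).+1 * 2 ^ k.

Lemma comp_numeral : computable numeral.
Proof. by move: comp_len comp_item => h1 h2; rewrite /numeral; comp. Qed.

Lemma numeral_cons n s :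
  numeral (CodeSeq.code (n :: s)) = n.+1 + (numeral (CodeSeq.code s)).*2.
Proof.
rewrite /numeral !len_code [size _]/= big_nat_recl // item_code muln1; congr (_ + _).
rewrite -muln2 big_distrl; apply: eq_bigr => k _.
by rewrite !item_code expnSr mulnA.
Qed.

Lemma numeral_surj n : exists2 p : word, numeral (choice.pickle p) = n & 2 ^ size p <= n.+1.
Proof.
elim/ltn_ind: n => -[|n] IH; first by exists [::] => //; rewrite /numeral /len !big_nil.
have [|p hp sp] := IH n./2; first by lia.
(* The letter [odd n] is the digit [1 + odd n], and [n.+1] is this digit plus twice [n./2]. *)
exists (odd n :: p).
  by rewrite pickle_word /= numeral_cons -pickle_word hp addSn odd_double_half.
by rewrite /= expnS; lia.
Qed.

Lemma pickle_word_lt (p : word) : choice.pickle p < 4 ^ size p.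
Proof.
rewrite pickle_word; elim: p => [//|b p IH].
rewrite [size _]/= -/(size p) expnS map_cons code_cons.
rewrite npairS; have b2 : 2 ^ nat_of_bool b <= 2 by case: b.
(* If [c] codes the tail, the whole code is at most [2 * (2c + 1)], which is less than
   [4 * (c + 1)]. *)
nia.
Qed.

(** Half of the invariance theorem: simulation by a good universal function lengthens words by a
    constant. *)
Lemma complexity_bound (D : Type) (F : set (word -> option D)) K G :
  complexity F K -> F G ->
  exists c, forall p x, G p = Some x -> K x <= size p + c.
Proof.
move=> [U [FU [comp [_ univ good]]] hK] /univ[e he].
have [c hc] := good e; exists c => p x; rewrite he => /(hK x).2 h.
exact: leq_trans h (hc p).
Qed.

(** The maps [e] and [e'] allow complexities on naturals to be compared with restrictions of
    complexities on integers. *)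
Lemma complexity_le (X D D' : Type) (F : set (word -> option D))
    (F' : set (word -> option D')) K K' (e : X -> D) (e' : X -> D') :
  complexity F K -> complexity F' K' ->
  (forall U, F U -> exists2 G, F' G &
     forall p x, U p = Some (e x) -> G p = Some (e' x)) ->
  le_ct (fun x => K' (e' x)) (fun x => K (e x)).
Proof.
move=> [U [FU _] hK] hK' /(_ U FU)[G FG hG].
have [c hc] := complexity_bound hK' FG; exists c => x.
by have [[p /hG /hc h <-] _] := hK (e x).
Qed.

Lemma not_le_ct (f g : nat -> nat) c :
  (forall p : word, exists2 x, g x <= size p + c & numeral (choice.pickle p) <= f x) ->
  ~ le_ct f g.
Proof.
(* With this value the assumed inequality forces [size p >= c + d + 10], whereas
   [2 ^ size p <= 2 * (c + d + 5) + 1] and [n < 2 ^ n] make [size p] smaller. *)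
move=> h [d hd]; have [p pv ps] := numeral_surj (c + d + 5).*2.
have [x h1] := h p; rewrite pv => h2; have := hd x.
have := ltn_expl (size p).-1 (isT : 1 < 2).
have e : 0 < size p -> 2 ^ size p = 2 * 2 ^ (size p).-1.
  by rewrite -expnS => /prednK ->.
lia.
Qed.

(* The point is that numeral p is exponential in the size of p. *)
Lemma complexity_separation (D D' : Type) (F : set (word -> option D))
    (F' : set (word -> option D')) K K' (e : nat -> D) (e' : nat -> D') :
  complexity F K -> complexity F' K' ->
  (forall U, F U -> exists2 G, F' G & forall p : word, exists2 x, G p = Some (e' x) &
     forall q, size q < numeral (choice.pickle p) -> U q <> Some (e x)) ->
  ~ le_ct (fun x => K (e x)) (fun x => K' (e' x)).
Proof.
move=> [U [FU _] hK] hK' /(_ U FU)[G FG hG].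
have [c hc] := complexity_bound hK' FG; apply: (@not_le_ct _ _ c) => p.
have [x /hc h1 h2] := hG p; exists x => //.
have [[q hq <-] _] := hK (e x).
by rewrite leqNgt; apply/negP => /h2.
Qed.

(** * Iterators describe exactly the computable values *)

Lemma the_graph (T : choiceType) (o : option T) : the [set y | o = Some y] = o.
Proof.
case: o => [y|]; first by apply: the_eq => // z [->].
by case e: (the _) => [y|] //; have := theP e.
Qed.

(** A path is a finite object: it isolates the values of [f] that are used, and it can be searched
    for. *)
Lemma iter_pfun_path (f : pfun) n x y : iter_pfun n f x = Some y <->
  exists w, [/\ nth 0 w 0 = x, nth 0 w n = y &
    forall k, k < n -> f (nth 0 w k) = Some (nth 0 w k.+1)].
Proof.
elim: n x => [|n IH] x /=; split.
- by move=> [->]; exists [:: y].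
- by move=> [w [-> -> _]].
- case ef: (f x) => [x'|] //= /IH[w [w0 wn wk]]; exists (x :: w); split=> //.
  by case=> [_|k] /=; [rewrite ef w0 | exact: wk].
move=> [w [w0 wn wk]]; rewrite -w0 (wk 0) //=; apply/IH.
by exists (behead w); split=> [||k kn]; rewrite !nth_behead // wk.
Qed.

Lemma iter_pfun_mono (f g : pfun) n x y : graph f `<=` graph g ->
  iter_pfun n f x = Some y -> iter_pfun n g x = Some y.
Proof.
move=> fg /iter_pfun_path[w [w0 wn wk]]; apply/iter_pfun_path.
by exists w; split=> // k /wk /(fg (_, _)).
Qed.

Lemma iter_pfun_succ n x : iter_pfun n (Some \o succn) x = Some (n + x).
Proof. by elim: n x => //= n IH x; rewrite IH addnS. Qed.

Lemma injective_succ : injective_pfun (Some \o succn).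
Proof.
by split=> [x y y' /= [<-] [<-]|x x' y /= [<-] [/esym]].
Qed.

Lemma finpfun_of_seq (s : seq (nat * nat)) : is_function [set` s] ->
  exists u : finpfun, Defs.fgraph u = [set` s].
Proof.
elim: s => [_|[x y] s IH fs].
  exists fmap0; apply/seteqP; split=> -[a b] //=.
  by rewrite /Defs.fgraph /graph /= fnd_fmap0.
have [|u hu] := IH.
  by move=> a b b' h h'; apply: (fs a b b'); rewrite /= inE ?h ?h' orbT.
exists (u.[x <- y])%fmap; apply/seteqP; split=> -[a b].
  rewrite /Defs.fgraph /graph /= fnd_set inE; case: eqP => [-> [->]|_ h].
    by rewrite eqxx.
  have : [set` s] (a, b) by rewrite -hu.
  by move=> /= ->; rewrite orbT.
rewrite /Defs.fgraph /graph /= fnd_set; case: eqP => [->|ne] h.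
  by rewrite (fs x b y) //= inE eqxx.
move: h; rewrite inE xpair_eqE => /orP[/andP[/eqP //]|h].
have : Defs.fgraph u (a, b) by rewrite hu.
by [].
Qed.

Lemma finpfun_seq (u : finpfun) : exists s : seq (nat * nat), Defs.fgraph u = [set` s].
Proof.
exists [seq (x, odflt 0 (u.[? x])%fmap) | x <- enum_fset (domf u)].
apply/seteqP; split=> -[a b]; rewrite /Defs.fgraph /graph /=.
  move=> h; apply/mapP; exists a; last by rewrite h.
  by rewrite -fndSome h.
move=> /mapP[x]; rewrite -fndSome => + [-> ->].
by case: (u.[? x])%fmap.
Qed.

Lemma item_pickle (l : seq (nat * nat)) k : k < size l ->
  item (choice.pickle l) k =
    kpair (nth (0, 0) l k).1 (nth (0, 0) l k).2.
Proof.
move=> kl; rewrite pickle_list item_code (nth_map (0, 0)) //.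
by case: (nth _ _ _) => a b; rewrite pickle_kpair.
Qed.

Lemma len_pickle (l : seq (nat * nat)) : len (choice.pickle l) = size l.
Proof. by rewrite pickle_list len_code size_map. Qed.

(* The value at 0 of [functional_of R p] applied to the successor function is
   found by searching R. *)
Lemma re_relation_code (R : finpfun_relation) : re_relation R ->
  exists c, forall p n,
    (forall u y, Defs.fgraph u `<=` graph (Some \o succn) -> R (u, p, 0, y) -> y = n) ->
    functional_of R p (Some \o succn) 0 = Some n ->
    sem c (choice.pickle p) = Some n.
Proof.
move=> [f [cf hf] fR].
have [T hT [mT sT]] := normal_form cf.
(* The listed graph is a finite part of the successor function. *)
pose okay s := ball (len s) (fun k =>
  item s k == kpair (kfst (item s k)) (kfst (item s k)).+1).
pose D q z := okay (nleft z) && (0 <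
  T (kpair (kpair (kpair (nleft z) q) 0) (nleft (nright z))) (nright (nright z))).
have hD : computable2 D.
  move: comp_len comp_item comp_kpair comp_kfst => h1 h2 h3 h4.
  by rewrite /D /okay; comp.
have [c hc] := search_code hD.
have [cy hy] : computable (fun z => nleft (nright z)) by comp.
exists (RComp cy c) => p n only /theP[u usub Ru] /=.
have DR z : D (choice.pickle p) z -> nleft (nright z) = n.
  move=> /andP[/ballP ok]; case e: (T _ _) => [//|v] _.
  (* The number found by the search is shown to code a genuine list of pairs, rebuilt from the first
     components. *)
  pose l := [seq (a, a.+1) | a <- map kfst (CodeSeq.decode (nleft z))].
  have el : nleft z = choice.pickle l.
    rewrite pickle_list -[LHS]CodeSeq.decodeK; congr CodeSeq.code.
    rewrite -map_comp -map_comp -[LHS]map_id; apply/eq_in_map => x /(nthP 0)[k kl <-].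
    move: (ok k); rewrite -[nleft z]CodeSeq.decodeK len_code item_code.
    rewrite CodeSeq.codeK => /(_ kl)/eqP e1; rewrite [LHS]e1.
    exact: esym (@pickle_kpair nat nat _ _).
  have : domain f (l, p, 0, nleft (nright z)).
    have : sem cf (choice.pickle (l, p, 0, nleft (nright z))) = Some v.
      by apply/sT; exists (nright (nright z)); rewrite !pickle_kpair -el.
    by rewrite hf; case ef: (f _) => [b|] // _; exists b.
  rewrite fR => -[v' el' Rv']; apply: (only v') => //.
  by rewrite el' => ab /= /mapP[a _ ->].
have [l lu] := finpfun_seq u.
have exz : exists z, D (choice.pickle p) z.
  have : domain f (l, p, 0, n) by rewrite fR; exists u.
  move=> [b fb].
  have /sT[t ht] : sem cf (choice.pickle (l, p, 0, n)) = Some b by rewrite hf fb.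
  exists (npair (choice.pickle l) (npair n t)); rewrite /D !(npairKl, npairKr).
  have -> : kpair (kpair (kpair (choice.pickle l) (choice.pickle p)) 0) n =
      choice.pickle (l, p, 0, n) by rewrite !pickle_kpair.
  rewrite ht andbT.
  apply/ballP => k; rewrite len_pickle => kl; rewrite item_pickle // kpairKl.
  have : Defs.fgraph u (nth (0, 0) l k) by rewrite lu /= mem_nth.
  by move=> /usub /= [<-].
have [z hz] := (hc _).2.1 exz.
by rewrite hz /= hy (DR z) //; exact: (hc _).1 hz.
Qed.

(** The flag [inj] makes one construction serve both families: the integer one accepts injective
    finite functions only. *)
Definition iterator_relation (inj : bool) (c : recfun) : finpfun_relation :=
  [set t | let: (u, p, x, y) := t in
     (inj -> is_injective_function (Defs.fgraph u)) /\
     exists2 n, sem c (choice.pickle p) = Some n &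
       iter_pfun n (fun x => u.[? x]%fmap) x = Some y].

Definition code_functional (inj : bool) (s : nat) : bool :=
  ball (len s) (fun k => ball (len s) (fun l =>
    ((kfst (item s k) == kfst (item s l)) ==>
      (ksnd (item s k) == ksnd (item s l))) &&
    (inj ==> ((ksnd (item s k) == ksnd (item s l)) ==>
      (kfst (item s k) == kfst (item s l)))))).

Lemma comp_code_functional inj : computable (code_functional inj).
Proof.
move: comp_len comp_item comp_kfst comp_ksnd => h1 h2 h3 h4.
by rewrite /code_functional; comp.
Qed.

Lemma code_functionalP inj (l : seq (nat * nat)) :
  code_functional inj (choice.pickle l) <->
  is_function [set` l] /\ (inj -> is_injective_function [set` l]).
Proof.
have nthl a b : (a, b) \in l -> exists2 k, k < size l & nth (0, 0) l k = (a, b).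
  by move=> /(nthP (0, 0))[k]; exists k.
split=> [/ballP h|[f1 f2]].
  have {}h k m : k < size l -> m < size l ->
      ((nth (0, 0) l k).1 = (nth (0, 0) l m).1 ->
       (nth (0, 0) l k).2 = (nth (0, 0) l m).2) /\
      (inj -> (nth (0, 0) l k).2 = (nth (0, 0) l m).2 ->
       (nth (0, 0) l k).1 = (nth (0, 0) l m).1).
    move=> kl ml; have := h k; rewrite len_pickle => /(_ kl)/ballP/(_ m ml).
    rewrite !item_pickle // !kpairKl !kpairKr.
    move=> /andP[/implyP i1 /implyP i2]; split; first by move=> /eqP/i1/eqP.
    by move=> /i2/implyP i3 /eqP/i3/eqP.
  have f : is_function [set` l].
    move=> x y y' /nthl[k kl ek] /nthl[m ml em].
    by have [h1 _] := h k m kl ml; rewrite ek em in h1; exact: h1.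
  split=> // i; split=> // x y y' /nthl[k kl ek] /nthl[m ml em].
  by have [_ /(_ i) h1] := h k m kl ml; rewrite ek em in h1; exact: h1.
apply/ballP => k; rewrite len_pickle => kl; apply/ballP => m ml.
rewrite !item_pickle // !kpairKl !kpairKr.
have := mem_nth (0, 0) kl; have := mem_nth (0, 0) ml.
case: (nth _ l k) (nth _ l m) => a b [a' b'] /= m1 m2.
apply/andP; split; first by apply/implyP => /eqP e; subst; apply/eqP/(f1 a').
apply/implyP => /f2[_ i]; apply/implyP => /eqP e; subst.
by apply/eqP; apply: (i _ _ b').
Qed.

Lemma iterator_relation_re inj c : re_relation (iterator_relation inj c).
Proof.
have [T hT [mT sT]] := normal_form c.
(* The search is for a stage [t] at which the code outputs [n], and for a path [w] of [n] edges
   taken from the list [s]. *)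
pose body s q x y t n w := [&& code_functional inj s, T q t == n.+1,
  item w 0 == x, item w n == y &
  ball n (fun k => bex (len s) (fun l =>
    item s l == kpair (item w k) (item w k.+1)))].
pose D a z := body (kfst (kfst (kfst a))) (ksnd (kfst (kfst a))) (ksnd (kfst a))
  (ksnd a) (nleft z) (nleft (nright z)) (nright (nright z)).
have hD : computable2 D.
  move: comp_len comp_item comp_kpair comp_kfst comp_ksnd => h1 h2 h3 h4 h5.
  move: (comp_code_functional inj) => h6.
  by rewrite /D /body; comp.
have [d hd] := search_code hD.
exists (fun a => sem d (choice.pickle a)).
  by exists d => a; case: (sem d _).
apply/seteqP; split=> -[[[s p] x] y].
  move=> /(hd _).2[z]; rewrite /D !pickle_kpair !(kpairKl, kpairKr).
  move: (nleft z) (nleft (nright z)) (nright (nright z)) => t n w.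
  move=> /and5P[/code_functionalP[f1 f2] /eqP ht /eqP w0 /eqP wn /ballP hw].
  have [u hu] := finpfun_of_seq f1; exists u => //.
  split; first by rewrite hu.
  exists n; first by apply/sT; exists t.
  apply/iter_pfun_path; exists (CodeSeq.decode w).
  rewrite -!item_code CodeSeq.decodeK; split=> // k kn; rewrite -!item_code.
  rewrite CodeSeq.decodeK; have /bexP[l] := hw k kn.
  rewrite len_pickle => ll; rewrite item_pickle // => /eqP e.
  have e1 : (nth (0, 0) s l).1 = item w k by rewrite -[LHS](kpairKl _ (nth (0, 0) s l).2) e kpairKl.
  have e2 : (nth (0, 0) s l).2 = item w k.+1 by rewrite -[LHS](kpairKr (nth (0, 0) s l).1) e kpairKr.
  have : Defs.fgraph u (item w k, item w k.+1).
    by rewrite hu /= -e1 -e2 -surjective_pairing mem_nth.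
  by [].
move=> [u hu [ui [n /sT[t ht] /iter_pfun_path[w [w0 wn wk]]]]].
apply/(hd _).2; exists (npair t (npair n (CodeSeq.code w))).
rewrite /D !pickle_kpair !(kpairKl, kpairKr, npairKl, npairKr).
apply/and5P; rewrite ht !item_code w0 wn; split=> //.
  apply/code_functionalP; rewrite -hu; split=> //.
  by move=> a b b'; rewrite /Defs.fgraph /graph /= => -> [].
apply/ballP => k /wk h; rewrite !item_code.
have : [set` s] (nth 0 w k, nth 0 w k.+1) by rewrite -hu.
move=> /= /(nthP (0, 0))[l ll e]; apply/bexP; exists l; first by rewrite len_pickle.
by rewrite item_pickle // e.
Qed.

Lemma functional_of_iterator (inj : bool) c (p : word) n (f : pfun) :
  sem c (choice.pickle p) = Some n -> (inj -> injective_pfun f) ->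
  functional_of (iterator_relation inj c) p f = iter_pfun n f.
Proof.
move=> cp fi; apply/funext => x; rewrite -[RHS]the_graph; congr the.
apply/seteqP; split=> [y [u uf [_ [m]]]|y h].
  by rewrite cp => -[<-]; exact: iter_pfun_mono.
have /iter_pfun_path[w [w0 wn wk]] := h.
(* The edges of the path form a finite part of [f] that suffices for the iterate. *)
pose s := [seq (nth 0 w k, nth 0 w k.+1) | k <- iota 0 n].
have sf : [set` s] `<=` graph f.
  by move=> ab /= /mapP[k]; rewrite mem_iota => /= /wk h1 ->.
have [|u hu] := @finpfun_of_seq s.
  by move=> a b b' /sf + /sf; rewrite /graph /= => -> [].
exists u; first by rewrite hu.
split.
  move=> /fi[f1 f2]; rewrite hu; split=> [a b b' /sf h1 /sf|a b b' /sf h1 /sf].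
    exact: f1.
  exact: f2.
exists n => //; apply/iter_pfun_path; exists w; split=> // k kn.
have : Defs.fgraph u (nth 0 w k, nth 0 w k.+1).
  by rewrite hu; apply/mapP; exists k; rewrite ?mem_iota.
by [].
Qed.

Lemma iterator_relation_functional (inj : bool) c u v p x y y' :
  iterator_relation inj c (u, p, x, y) -> iterator_relation inj c (v, p, x, y') ->
  is_function (Defs.fgraph u `|` Defs.fgraph v) -> y = y'.
Proof.
move=> [_ [n cn h]] [_ [m]]; rewrite cn => -[<-{m}] h' fuv.
(* Both finite functions are contained in [g], whose [n]-th iterate has at most one value at [x]. *)
pose g : pfun := fun a => the [set b | (Defs.fgraph u `|` Defs.fgraph v) (a, b)].
have sub : Defs.fgraph u `|` Defs.fgraph v `<=` graph g.
  by move=> [a b] hab; apply: the_eq => //= b' hab'; apply: fuv hab' hab.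
have e : iter_pfun n g x = Some y.
  by apply: iter_pfun_mono h => ab hab; apply: sub; left.
have e' : iter_pfun n g x = Some y'.
  by apply: iter_pfun_mono h' => ab hab; apply: sub; right.
by rewrite e in e'; case: e'.
Qed.

(** On the image of [e] the family is as strong as the partial recursive functions, so its
    complexity there is the plain one. Words that describe no value of this image are left
    unconstrained. *)
Definition describes_computably (D : Type) (F : set (word -> option D))
    (e : nat -> D) : Prop :=
  (forall U, F U -> exists c, forall p n,
     U p = Some (e n) -> sem c (choice.pickle p) = Some n) /\
  (forall c, exists2 G, F G & forall p n,
     sem c (choice.pickle p) = Some n -> G p = Some (e n)).

Lemma describes_le (D D' : Type) (F : set (word -> option D))
    (F' : set (word -> option D')) K K' (e : nat -> D) (e' : nat -> D') :
  complexity F K -> complexity F' K' ->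
  describes_computably F e -> describes_computably F' e' ->
  le_ct (fun n => K' (e' n)) (fun n => K (e n)).
Proof.
move=> hK hK' [h _] [_ h']; apply: (complexity_le hK hK') => U FU.
have [c hc] := h U FU; have [G FG hG] := h' c.
by exists G => // p n /hc /hG.
Qed.

Lemma Church_nat_describes : describes_computably Church_nat_family id.
Proof.
split=> [_ [R [Rre Rf] <-]|c].
  have [c hc] := re_relation_code Rre; exists c => p n /theP hn; apply: hc.
    (* Two finite parts of the successor function are compatible, so functionality of [R] leaves no
       other value than [n]. *)
    move=> u y us Ru; have : functional_of R p (Some \o succn) 0 = Some n.
      by rewrite hn iter_pfun_succ addn0.
    move=> /theP[v vs Rv]; apply: Rf Ru Rv _ => a b b' h1 h2.
    have sub ab : (Defs.fgraph u `|` Defs.fgraph v) ab -> graph (Some \o succn) ab.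
      by move=> []; [exact: us | exact: vs].
    by have := sub _ h1; have := sub _ h2; rewrite /graph /= => -[<-] [<-].
  by rewrite hn iter_pfun_succ addn0.
pose R := iterator_relation false c.
exists (fun p => Church_nat (functional_of R p)).
  exists R => //; split; first exact: iterator_relation_re.
  by move=> u v p x y y'; exact: iterator_relation_functional.
move=> p n hn; apply: the_eq => [f|m /= hm].
  exact: functional_of_iterator hn _.
have := congr1 (fun g => g 0) (hm (Some \o succn)).
rewrite /R (functional_of_iterator hn) // !iter_pfun_succ !addn0.
by case.
Qed.

Lemma Church_int_describes : describes_computably Church_int_family Posz.
Proof.
split=> [_ [R [Rre Ri Rf] <-]|c].
  have [c hc] := re_relation_code Rre; exists c => p n /theP hn; apply: hc.
    move=> u y us Ru; have : functional_of R p (Some \o succn) 0 = Some n.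
      by rewrite (hn _ injective_succ) /= iter_pfun_succ addn0.
    move=> /theP[v vs Rv]; apply: Rf Ru Rv _.
    have sub ab : (Defs.fgraph u `|` Defs.fgraph v) ab -> graph (Some \o succn) ab.
      by move=> []; [exact: us | exact: vs].
    have [s1 s2] := injective_succ.
    by split=> [a b b' /sub h1 /sub|a b b' /sub h1 /sub]; [exact: s1 | exact: s2].
  by rewrite (hn _ injective_succ) /= iter_pfun_succ addn0.
pose R := iterator_relation true c.
exists (fun p => Church_int (functional_of R p)).
  exists R => //; split; first exact: iterator_relation_re.
    by move=> u p x y [/(_ isT)].
  move=> u v p x y y' h h' [f _].
  exact: iterator_relation_functional h h' f.
move=> p n hn; apply: the_eq => [f fi|m /= hm].
  by rewrite /R (functional_of_iterator hn).
have := congr1 (fun g => g 0) (hm _ injective_succ).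
rewrite /R (functional_of_iterator hn) ?iter_pfun_succ; last first.
  by move=> _; exact: injective_succ.
case: m {hm} => m; first by rewrite /= iter_pfun_succ !addn0 => -[->].
(* A negative exponent is impossible: 0 is not a successor, so the inverse is undefined there. *)
rewrite /=; case e: (inv_pfun _ 0) => [x|] //.
by have := theP e.
Qed.

Lemma describes_zero (F : set (word -> option nat)) :
  describes_computably F id -> exists2 G, F G & forall p, G p = Some 0.
Proof.
move=> [_ /(_ RZero)[G FG hG]]; exists G => // p.
exact: hG.
Qed.

Lemma Delta_sub (F : set (word -> option nat)) F1 F2 :
  F F1 -> F F2 -> exists2 G, Delta F G &
    forall p m n, F1 p = Some m -> F2 p = Some n -> G p = Some (m%:Z - n%:Z)%R.
Proof.
move=> h1 h2; eexists; first by exists F1 => //; exists F2.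
by move=> q a b /= -> ->.
Qed.

Lemma DeltaP (F : set (word -> option nat)) U : Delta F U ->
  exists F1 F2, [/\ F F1, F F2 & forall p (n : nat), U p = Some n%:Z%R ->
    exists2 m, F1 p = Some (m + n) & F2 p = Some m].
Proof.
move=> [F1 h1 [F2 h2 <-]]; exists F1, F2; split=> // p n /=.
case: (F1 p) => [a|] //=; case: (F2 p) => [b|] //= [e].
by exists b => //; congr Some; lia.
Qed.

(** Differences of computed numbers are computed, truncated subtraction being exact when the result
    is natural; conversely a value is its difference with 0. *)
Lemma Delta_describes (F : set (word -> option nat)) :
  describes_computably F id -> describes_computably (Delta F) Posz.
Proof.
move=> hF; have [hF1 hF2] := hF; split=> [U /DeltaP[F1 [F2 [h1 h2 hU]]]|c].
  have [c1 hc1] := hF1 _ h1; have [c2 hc2] := hF1 _ h2.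
  have [d hd] : computable2 subn by comp.
  exists (RComp d (RPair c1 c2)) => p n /hU[m /hc1 e1 /hc2 e2] /=.
  by rewrite e1 e2 /= hd npairKl npairKr addKn.
have [Z FZ hZ] := describes_zero hF; have [G FG hG] := hF2 c.
have [G' FG' hG'] := Delta_sub FG FZ; exists G' => // p n /hG e.
by rewrite (hG' _ _ _ e (hZ p)) GRing.subr0.
Qed.

(** * The hierarchy *)

Lemma log2_gt_Church (F : set (word -> option nat)) K :
  complexity F K -> describes_computably F id -> gt_ct log2 K.
Proof.
move=> hK [_ desc]; have [cv hv] := comp_numeral; split.
  have [G FG hG] := desc cv; have [c hc] := complexity_bound hK FG.
  (* From [2 ^ size p <= n.+1] one only gets [size p <= log2 n + 1]. *)
  exists c.+1 => n; have [p pn ps] := numeral_surj n.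
  have /hc le : G p = Some n by apply: hG; rewrite hv pn.
  rewrite (leq_trans le) // addnS -addSn leq_add2r /log2.
  case: (posnP (size p)) => [-> //|s0]; rewrite -(prednK s0) ltnS.
  by apply: trunc_log_max => //; rewrite -(prednK s0) expnS in ps; lia.
have [ce he] : computable (fun q => 2 ^ numeral q) by move: comp_numeral => h; comp.
have [G FG hG] := desc ce; have [c hc] := complexity_bound hK FG.
apply: (@not_le_ct _ _ c) => p; exists (2 ^ numeral (choice.pickle p)).
  by apply: hc; apply: hG; rewrite he.
by rewrite /log2 trunc_expnK.
Qed.

Lemma stage_value c T q n t : approximates T (sem c) -> sem c q = Some n ->
  T q t = 0 \/ T q t = n.+1.
Proof.
move=> [_ sT] cq; case e: (T q t) => [|m]; [by left|right].
have : sem c q = Some m by apply/sT; exists t.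
by rewrite cq => -[->].
Qed.

(** Makes a computed value the cardinal of an r.e. set: the segment below it is enumerated once the
    value is known. *)
Lemma stage_lt c T q n : approximates T (sem c) -> sem c q = Some n ->
  [set x | exists t, x < (T q t).-1] = `I_n.
Proof.
move=> aT cq; apply/seteqP; split=> x /=.
  by move=> [t]; case: (stage_value t aT cq) => ->.
have [t ht] := (aT.2 _ _).1 cq.
by exists t; rewrite ht.
Qed.

Lemma cardinal_family_computable phi c : acceptable phi ->
  exists2 G, cardinal_family phi G &
    forall p n, sem c (choice.pickle p) = Some n -> G p = Some n.
Proof.
move=> ha; have [T hT aT] := normal_form c.
have [|h hr hE] := @card_index phi (fun q x t => x < (T q t).-1) ha.
  by comp.
exists (fun p => cardinal (domain (phi (h p)))); first by exists h.
by move=> p n cp; apply: hE; rewrite (stage_lt aT cp).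
Qed.

(** Uses the empty relation, since [eqv_index_index] only yields positive indices. *)
Lemma eqv_index_family_zero phi : acceptable phi ->
  exists2 G, eqv_index_family phi G & forall p, G p = Some 0.
Proof.
move=> ha; have [|h hr hE] := @acceptable_index _ phi (fun _ _ _ => false) ha.
  by comp.
exists (fun p => eqv_index (domain (phi (h p)))); first by exists h.
move=> p; rewrite hE -[RHS]eqv_index0; congr eqv_index.
by apply/seteqP; split=> [a []|].
Qed.

Lemma pickle_below (p q : word) : size q < numeral (choice.pickle p) ->
  choice.pickle q < 4 ^ numeral (choice.pickle p).
Proof.
move=> h; apply: leq_trans (pickle_word_lt q) _.
by rewrite leq_exp2l // ltnW.
Qed.

Lemma card_ge (X : set nat) n m (f : nat -> nat) : X #= `I_n ->
  injective f -> (forall j, j < m -> X (f j)) -> m <= n.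
Proof.
move=> Xn fi h; rewrite -(size_iota 0 m) -(size_map f).
apply: card_size_le Xn _ _; first by rewrite map_inj_uniq ?iota_uniq.
by move=> x /mapP[j]; rewrite mem_iota => /= jm ->; exact: h.
Qed.

Lemma finite_pairs N (g : nat -> nat) (X : set nat) :
  (forall a, X a -> nleft a < N /\ nright a < g (nleft a)) ->
  exists n, X #= `I_n.
Proof.
move=> h; apply/finite_setP.
apply: (@sub_finite_set _ _
  [set` [seq npair q j | q <- iota 0 N, j <- iota 0 (g q)]]).
  move=> a /h[qN jg] /=; rewrite -[a]npair_surj.
  by apply/allpairsPdep; exists (nleft a), (nright a); rewrite !mem_iota.
by apply/finite_seqP; eexists.
Qed.

(* Below 4 ^ i there are codes of all the words of length at most i; the sum of
   the values described by these words is enumerable from i. *)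
Lemma Church_gt_card F phi K K' : acceptable phi ->
  complexity F K -> describes_computably F id ->
  complexity (cardinal_family phi) K' -> gt_ct K K'.
Proof.
move=> ha hK [desc _] hK'; split.
  apply: (@complexity_le _ _ _ _ _ _ _ id id hK hK') => U /desc[c hc].
  have [G FG hG] := cardinal_family_computable c ha.
  by exists G => // p x /hc /hG.
apply: (@complexity_separation _ _ _ _ _ _ id id hK hK') => U /desc[c hc].
have [T hT aT] := normal_form c.
(* A disjoint union of the segments below the values computed from the codes under the bound; the
   extra point 0 makes its size exceed each of these values. *)
pose D q x t := (x == 0) || [&& 0 < x, nleft x.-1 < 4 ^ numeral q &
  nright x.-1 < (T (nleft x.-1) t).-1].
have hD : computable3 D by move: comp_numeral => h; rewrite /D; comp.
have [h hr hE] := card_index ha hD.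
exists (fun p => cardinal (domain (phi (h p)))); first by exists h.
move=> p; pose X := [set x | exists t, D (choice.pickle p) x t].
pose N := 4 ^ numeral (choice.pickle p).
pose Y := [set a | nleft a < N /\ exists t, nright a < (T (nleft a) t).-1].
have [n hn] : exists n, Y #= `I_n.
  apply: (@finite_pairs N (fun q => odflt 0 (sem c q))) => a [aN [t ht]].
  split=> //; case e: (T (nleft a) t) ht => [//|m] /= ht.
  by have -> : sem c (nleft a) = Some m by apply/aT.2; exists t.
have Xn : X #= `I_n.+1.
  apply/eq_cardSP; exists 0; first by exists 0.
  have -> : X `\ 0 = succn @` Y.
    apply/seteqP; split=> [[|a] [[t /= h1] h2] //|_ [a [aN [t ht]] <-]].
      by exists a => //; case/and3P: h1 => _ ? ?; split=> //; exists t.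
    by split=> //; exists t; rewrite /D /= -/N aN.
  by apply: card_eq_trans hn; apply: inj_card_eq => x y _ _ [].
exists n.+1; first exact: hE.
move=> q /pickle_below qN /hc cq.
have : n.+1 <= n.
  apply: (@card_ge Y _ _ (npair (choice.pickle q)) hn) => [x y e|j jn].
    by rewrite -(npairKr (choice.pickle q) x) e npairKr.
  rewrite /Y /mkset npairKl npairKr; split=> //.
  have : `I_n.+1 j by [].
  by rewrite -(stage_lt aT cq).
by rewrite ltnn.
Qed.

Lemma card_ge_Delta phi K K' : acceptable phi ->
  complexity (cardinal_family phi) K ->
  complexity (Delta (cardinal_family phi)) K' -> le_ct (restrict_nat K') K.
Proof.
move=> ha hK hK'; apply: (@complexity_le _ _ _ _ _ _ _ id Posz hK hK') => U FU.
have [Z FZ hZ] := cardinal_family_computable RZero ha.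
have [G FG hG] := Delta_sub FU FZ; exists G => // p x /hG e.
by rewrite (e _ (hZ p 0 erefl)) GRing.subr0.
Qed.

Lemma index_ge_Delta phi K K' : acceptable phi ->
  complexity (eqv_index_family phi) K ->
  complexity (Delta (eqv_index_family phi)) K' -> le_ct (restrict_nat K') K.
Proof.
move=> ha hK hK'; apply: (@complexity_le _ _ _ _ _ _ _ id Posz hK hK') => U FU.
have [Z FZ hZ] := eqv_index_family_zero ha.
have [G FG hG] := Delta_sub FU FZ; exists G => // p x /hG e.
by rewrite (e _ (hZ p)) GRing.subr0.
Qed.

(** * Cardinals as limits, compared with indices *)

Definition count_stage (W : nat -> nat -> nat -> bool) (q t : nat) : nat :=
  \sum_(0 <= x < t) W q x t.

Lemma count_stageE (W : nat -> nat -> nat -> bool) q t :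
  count_stage W q t = size [seq x <- iota 0 t | W q x t].
Proof.
rewrite /count_stage /index_iota subn0 size_filter -sum1_count [RHS]big_mkcond.
by apply: eq_bigr => x _; case: (W q x t).
Qed.

Lemma comp_count_stage (W : nat -> nat -> nat -> bool) : computable3 W -> computable2 (count_stage W).
Proof. by move=> hW; rewrite /count_stage; comp. Qed.

(** Past some stage every element has been enumerated and lies below the stage, so the count is
    final. *)
Lemma count_stage_eventually (W : nat -> nat -> nat -> bool) q n :
  (forall a t t', W q a t -> t <= t' -> W q a t') ->
  [set a | exists t, W q a t] #= `I_n ->
  exists t0, forall t, t0 <= t -> count_stage W q t = n.
Proof.
move=> mW hn; have /card_uniq_seq[s [us sn Xs]] := hn.
have [t0 ht0] : exists t0, forall x, x \in s -> x < t0 /\ W q x t0.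
  have : forall x, x \in s -> exists t, W q x t.
    by move=> x xs; have : [set` s] x by []; rewrite -Xs.
  elim: s {us sn Xs} => [|x s IH] h; first by exists 0.
  have [|t1 h1] := IH; first by move=> y ys; apply: h; rewrite inE ys orbT.
  have [|t2 h2] := h x; first by rewrite inE eqxx.
  exists (t1 + t2 + x.+1) => y; rewrite inE => /predU1P[->|/h1[yt Wy]].
    by split; [rewrite leq_addl | apply: mW h2 _; lia].
  by split; [lia | apply: mW Wy _; lia].
exists t0 => t tt; apply/eqP; rewrite eqn_leq count_stageE; apply/andP; split.
  apply: card_size_le hn _ _; first by rewrite filter_uniq ?iota_uniq.
  by move=> x; rewrite mem_filter => /andP[Wx _]; exists t.
rewrite -sn; apply: uniq_leq_size => // x /ht0[xt Wx].
rewrite mem_filter mem_iota /= add0n (leq_trans xt tt) andbT.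
exact: mW Wx tt.
Qed.

Lemma le_ct_succ f g : le_ct (f \o succn) (g \o succn) -> le_ct f g.
Proof.
move=> [c hc]; exists (c + f 0) => -[|n]; first by lia.
by have := hc n; rewrite /=; lia.
Qed.

(* The description n >= 1 is the index of an equivalence with one dead class and
   n - 1 others; 0 is left aside. *)
Lemma Delta_card_ge_index phi1 phi2 K K' : acceptable phi1 -> acceptable phi2 ->
  complexity (Delta (cardinal_family phi1)) K ->
  complexity (eqv_index_family phi2) K' -> le_ct K' (restrict_nat K).
Proof.
move=> ha1 ha2 hK hK'; apply: le_ct_succ.
apply: (@complexity_le _ _ _ _ _ _ _ (Posz \o succn) succn hK hK').
move=> U /DeltaP[F1 [F2 [[h1 hr1 <-] [h2 hr2 <-] hU]]].
have [W1 hW1 [m1 d1]] := acceptable_stages ha1 hr1.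
have [W2 hW2 [m2 d2]] := acceptable_stages ha1 hr2.
pose c1 := count_stage W1; pose c2 := count_stage W2.
have hc1 : computable2 c1 by exact: comp_count_stage.
have hc2 : computable2 c2 by exact: comp_count_stage.
(* The witness [t] claims that both counts are final, and every [s] tests the claim. The bound on
   [x.+1] leaves one point fewer than the difference, to be made up by the dead class. *)
pose D q x t s := [&& c1 q (t + s) == c1 q t, c2 q (t + s) == c2 q t &
  x.+1 < c1 q t - c2 q t].
have [|h hr hE] := @eqv_index_index phi2 D ha2; first by rewrite /D; comp.
exists (fun p => eqv_index (domain (phi2 (h p)))); first by exists h.
move=> p x /hU[m]; set q := choice.pickle p.
have Wd (W : nat -> nat -> nat -> bool) k :
    (forall (p : word) (a : nat), domain (phi1 (k p)) a <->
       exists t, W (choice.pickle p) (choice.pickle a) t) ->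
    domain (phi1 (k p)) = [set a | exists t, W q a t].
  by move=> d; apply/seteqP; split=> a /d.
move=> /cardinalP; rewrite (Wd _ _ d1) => /(count_stage_eventually (m1 q))[t1 e1].
move=> /cardinalP; rewrite (Wd _ _ d2) => /(count_stage_eventually (m2 q))[t2 e2].
apply: hE; rewrite -/q.
suff -> : [set a | exists z, forall t, D q a z t] = `I_x by exact: card_eqxx.
apply/seteqP; split=> [a [t ht]|a /= ax].
  have /and3P[/eqP f1 /eqP f2] := ht (t1 + t2).
  rewrite -f1 -f2 /c1 /c2 e1 ?e2 /=; lia.
exists (t1 + t2) => t; rewrite /D /c1 /c2 !e1 ?e2 ?eqxx /=; lia.
Qed.

(** A difference is at most its minuend. The segments below the final counts of the minuends, for
    all short words, form a Sigma_2 set; the index obtained is one more than its size and exceeds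
    all these differences. *)
Lemma Delta_card_not_le_index phi1 phi2 K K' : acceptable phi1 -> acceptable phi2 ->
  complexity (Delta (cardinal_family phi1)) K ->
  complexity (eqv_index_family phi2) K' -> ~ le_ct (restrict_nat K) K'.
Proof.
move=> ha1 ha2 hK hK'.
apply: (@complexity_separation _ _ _ _ _ _ Posz id hK hK').
move=> U /DeltaP[F1 [F2 [[h1 hr1 <-] _ hU]]].
have [W hW [mW dW]] := acceptable_stages ha1 hr1.
pose c := count_stage W; have hc : computable2 c by exact: comp_count_stage.
pose D q x t s := [&& nleft x < 4 ^ numeral q,
  c (nleft x) (t + s) == c (nleft x) t & nright x < c (nleft x) t].
have [|h hr hE] := @eqv_index_index phi2 D ha2.
  by move: comp_numeral => hv; rewrite /D; comp.
exists (fun p => eqv_index (domain (phi2 (h p)))); first by exists h.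
move=> p; pose X := [set x | exists z, forall t, D (choice.pickle p) x z t].
have [n hn] : exists n, X #= `I_n.
  (* A code whose count never settles contributes no point, so the default 0 is harmless. *)
  pose lim q := xget 0 [set v | exists t, c q t = v /\ forall s, c q (t + s) = v].
  apply: (@finite_pairs (4 ^ numeral (choice.pickle p)) lim) => a [t ht].
  have /and3P[aN _ ac] := ht 0; split=> //.
  have st s : c (nleft a) (t + s) = c (nleft a) t.
    by have /and3P[_ /eqP] := ht s.
  rewrite /lim; case: xgetP => [v _ [t' [e1 e2]]|no].
    by rewrite -(e2 t) addnC st.
  by case: (no (c (nleft a) t)); exists t.
exists n.+1; first exact: hE.
move=> q /pickle_below qN /hU[m /cardinalP hm _].
have [|t0 ht0] := @count_stage_eventually W (choice.pickle q) (m + n.+1) (mW _).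
  suff <- : domain (phi1 (h1 q)) = [set a | exists t, W (choice.pickle q) a t] by [].
  by apply/seteqP; split=> a /dW.
have : m + n.+1 <= n.
  apply: (@card_ge X _ _ (npair (choice.pickle q)) hn) => [x y e|j jn].
    by rewrite -(npairKr (choice.pickle q) x) e npairKr.
  exists t0 => s; rewrite /D !npairKl npairKr qN /c !ht0 ?leq_addr //.
  by rewrite eqxx.
lia.
Qed.

(** * Missing numbers as differences of suprema *)

(* If [N.+1 * total Z + n] is maximal, then every Z q is as long as P and N allow,
   and n is the least number which is not the size of some Z q. *)
Lemma missing_number (N : nat) (P : nat -> seq nat -> Prop) :
  (forall q, P q [::]) ->
  let total Z := \sum_(0 <= q < N) size (Z q) in
  let config Z n := [/\ forall q, q < N -> P q (Z q) /\ size (Z q) <= N, n <= N &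
    forall m, m < n -> exists2 q, q < N & size (Z q) = m] in
  exists S n, [/\ exists2 Z, config Z n & total Z = S,
    forall Z n', config Z n' -> N.+1 * total Z + n' <= N.+1 * S + n &
    forall q, q < N -> ~ exists xs,
      [/\ P q xs, size xs = n & forall ys, P q ys -> size ys <= n]].
Proof.
move=> P0 total config.
pose attained v := `[< exists Z n, config Z n /\ v = N.+1 * total Z + n >].
have exv : exists v, attained v.
  exists (N.+1 * total (fun=> [::]) + 0); apply/asboolP.
  by exists (fun=> [::]), 0; split.
have bound v : attained v -> v <= N.+1 * (N * N) + N.
  move=> /asboolP[Z [n [[hP nN _] ->]]]; rewrite leq_add // leq_mul2l /=.
  have -> : N * N = \sum_(0 <= q < N) N by rewrite sum_nat_const_nat subn0.
  rewrite /total !big_nat.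
  by apply: leq_sum => q /andP[_ /hP[]].
have [v /asboolP[Z [n [cZ ev]]] vmax] := ex_maxnP exv bound.
have {}vmax Z' n' : config Z' n' -> N.+1 * total Z' + n' <= N.+1 * total Z + n.
  by move=> c'; rewrite -ev; apply: vmax; apply/asboolP; exists Z', n'.
exists (total Z), n; split=> //; first by exists Z.
have [hP nN hit] := cZ.
(* If [n] were a size, either [n.+1] would do better, or [n = N] and the [N] sequences would have
   [N.+1] distinct sizes. *)
have nhit q : q < N -> size (Z q) <> n.
  move=> qN e; case: (ltngtP n N) => [lt|gt|eN].
  - have /vmax : config Z n.+1; last by rewrite addnS ltnn.
    split=> // m; rewrite ltnS leq_eqVlt => /predU1P[->|/hit //].
    by exists q.
  - by rewrite ltnNge nN in gt.
  - have : size (iota 0 N.+1) <= size [seq size (Z q) | q <- iota 0 N].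
      apply: uniq_leq_size; first exact: iota_uniq.
      move=> m; rewrite mem_iota /= add0n ltnS leq_eqVlt => /predU1P[->|].
        by apply/mapP; exists q; rewrite ?mem_iota ?e.
      rewrite -eN => /hit[q' q'N <-]; apply/mapP; exists q' => //.
      by rewrite mem_iota eN.
    by rewrite size_map !size_iota ltnn.
move=> q qN [xs [Pxs sxs max]].
have lt : size (Z q) < n.
  by rewrite ltn_neqAle max ?andbT; [apply/eqP/nhit | case: (hP q qN)].
(* Lengthening [Z q] gains at least [N.+1], more than the at most [N] lost by resetting [n] to 0. *)
pose Z' := fun k => if k == q then xs else Z k.
have : config Z' 0.
  split=> // k kN; rewrite /Z'; case: eqP => [->|_]; last exact: hP.
  by rewrite sxs.
move=> /vmax; rewrite addn0.
have -> : total Z' = total Z + (n - size (Z q)).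
  have memq : q \in index_iota 0 N by rewrite mem_index_iota.
  rewrite /total !(bigD1_seq q memq (iota_uniq _ _)) /= {1}/Z' eqxx sxs.
  rewrite (eq_bigr (fun k => size (Z k))) => [|k /negbTE nk]; last first.
    by rewrite /Z' nk.
  by lia.
by rewrite mulnDr leq_add2l; nia.
Qed.

(* [E q x t] enumerates the points of the q-th set and [V q x y t] the forbidden
   pairs of points. *)
Definition admissible (E : nat -> nat -> nat -> bool)
    (V : nat -> nat -> nat -> nat -> bool) (q : nat) (xs : seq nat) : Prop :=
  (forall k, k < size xs -> exists t, E q (nth 0 xs k) t) /\
  (forall k l, k < size xs -> l < k -> forall t, ~~ V q (nth 0 xs l) (nth 0 xs k) t).

(** The family of sequences is coded by [z]. The points are witnessed as enumerated by stage [s], to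
    be quantified existentially; the absence of forbidden pairs is tested at [t], to be quantified
    universally. *)
Definition config_stage (E : nat -> nat -> nat -> bool)
    (V : nat -> nat -> nat -> nat -> bool) (N z n s t : nat) : bool :=
  [&& ball N (fun q => (len (item z q) <= N) &&
        ball (len (item z q)) (fun k => E q (item (item z q) k) s &&
          ball k (fun l =>
            ~~ V q (item (item z q) l) (item (item z q) k) t))),
      n <= N &
      ball n (fun m => bex N (fun q => len (item z q) == m))].

Definition config_total (N z : nat) : nat := \sum_(0 <= q < N) len (item z q).

(** Over all configurations, the bound has the minuend as its maximum for [b = 1] and the subtrahend
    for [b = 0]. *)
Definition below_config (E : nat -> nat -> nat -> bool)
    (V : nat -> nat -> nat -> nat -> bool) (b N x z t : nat) : bool :=
  config_stage E V N (nleft z) (nleft (nright z)) (nright (nright z)) t &&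
  (x < N.+1 * config_total N (nleft z) + b * nleft (nright z)).

Lemma comp_below_config (E : nat -> nat -> nat -> bool)
    (V : nat -> nat -> nat -> nat -> bool) b : computable3 E -> computable4 V ->
  computable4 (fun p x z t => below_config E V b (4 ^ numeral p) x z t).
Proof.
move=> hE hV; move: comp_len comp_item comp_numeral => h1 h2 h3.
by rewrite /below_config /config_stage /config_total; comp.
Qed.

(** As configurations have [n <= N], maximality of [N.+1 * S + n] forces [S] to be the maximal total
    as well; hence the same [S] and [n] give both suprema. *)
Lemma below_config_card (E : nat -> nat -> nat -> bool)
    (V : nat -> nat -> nat -> nat -> bool) N :
  (forall q x t t', E q x t -> t <= t' -> E q x t') ->
  exists S n,
    (forall b, b <= 1 ->
      [set x | exists z, forall t, below_config E V b N x z t] = `I_(N.+1 * S + b * n)) /\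
    forall q, q < N -> ~ exists xs, [/\ admissible E V q xs, size xs = n &
      forall ys, admissible E V q ys -> size ys <= n].
Proof.
move=> mE.
have [|S [n [[Z cZ tZ] max missing]]] := @missing_number N (admissible E V).
  by move=> q; split.
exists S, n; split=> // b b1.
pose seqs z q := CodeSeq.decode (item z q).
have itemE z q k : item (item z q) k = nth 0 (seqs z q) k.
  by rewrite -item_code CodeSeq.decodeK.
have lenE z q : len (item z q) = size (seqs z q).
  by rewrite -len_code CodeSeq.decodeK.
apply/seteqP; split=> x /=.
  move=> [z hz]; set m := nleft (nright z).
  have cz : [/\ forall q, q < N -> admissible E V q (seqs (nleft z) q) /\
      size (seqs (nleft z) q) <= N, m <= N &
      forall k, k < m -> exists2 q, q < N & size (seqs (nleft z) q) = k].
    have /andP[/and3P[/ballP h1 mN /ballP h3] _] := hz 0.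
    split=> // [q qN|k /h3/bexP[q qN /eqP e]]; last by exists q => //; rewrite -lenE.
    have /andP[le /ballP h4] := h1 q qN; rewrite -lenE; split=> //.
    split=> [k|k l]; rewrite -lenE -!itemE => kl.
      by have /andP[Ek _] := h4 _ kl; exists (nright (nright z)).
    move=> lk t; have /andP[/and3P[/ballP h5 _ _] _] := hz t.
    by have /andP[_ /ballP/(_ _ kl)/andP[_ /ballP/(_ _ lk)]] := h5 q qN.
  have /andP[_] := hz 0.
  have -> : config_total N (nleft z) = \sum_(0 <= q < N) size (seqs (nleft z) q).
    by apply: eq_bigr => q _; rewrite lenE.
  have := max _ _ cz; have [_ mN _] := cz; have [_ nN _] := cZ.
  move: (\sum_(0 <= q < N) _) => S'; rewrite -/m.
  case: b b1 {hz} => [|[|//]] _; rewrite ?mul1n ?mul0n ?addn0; last first.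
    by move=> h1 h2; exact: leq_trans h2 h1.
  move=> h1 h2; apply: leq_trans h2 _; rewrite leq_mul2l /=.
  by rewrite leqNgt; apply/negP => lt; nia.
move=> xlt; have [hP nN hit] := cZ.
pose z := CodeSeq.code (mkseq (fun q => CodeSeq.code (Z q)) N).
have seqsz q : q < N -> item z q = CodeSeq.code (Z q).
  by move=> qN; rewrite item_code nth_mkseq.
have [s hs] : exists s, forall q k, q < N -> k < size (Z q) -> E q (nth 0 (Z q) k) s.
  have [f hf] : exists f, forall q k, q < N -> k < size (Z q) ->
      E q (nth 0 (Z q) k) (f q k).
    have /choice[f hf] : forall qk : nat * nat, exists t, qk.1 < N ->
        qk.2 < size (Z qk.1) -> E qk.1 (nth 0 (Z qk.1) qk.2) t.
      move=> [q k] /=; have [qN|] := boolP (q < N); last by exists 0.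
      have [[h _] _] := hP q qN.
      by have [/h[t ht]|] := boolP (k < size (Z q)); [exists t | exists 0].
    by exists (fun q k => f (q, k)) => q k; exact: hf (q, k).
  exists (\max_(q < N) \max_(k < N) f q k) => q k qN kZ.
  apply: mE (hf q k qN kZ) _.
  have kN : k < N by apply: leq_trans kZ _; case: (hP q qN).
  apply: leq_trans (leq_bigmax (Ordinal qN)).
  exact: (leq_bigmax (F := fun k : 'I_N => f q k) (Ordinal kN)).
exists (npair z (npair n s)) => t.
rewrite /below_config !(npairKl, npairKr); apply/andP; split; last first.
  rewrite (_ : config_total N z = S) // -tZ /config_total !big_nat.
  by apply: eq_bigr => q /andP[_ qN]; rewrite seqsz // len_code.
apply/and3P; split=> //; apply/ballP.
  move=> q qN; rewrite seqsz // len_code; have [[_ hV] le] := hP q qN.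
  rewrite le; apply/ballP => k kZ; rewrite !item_code hs //=; apply/ballP => l lk.
  by rewrite !item_code; exact: hV.
by move=> m /hit[q qN e]; apply/bexP; exists q => //; rewrite seqsz // len_code e.
Qed.

Lemma card_not_le_Delta phi K K' : acceptable phi ->
  complexity (cardinal_family phi) K ->
  complexity (Delta (cardinal_family phi)) K' -> ~ le_ct K (restrict_nat K').
Proof.
move=> ha hK hK'.
apply: (@complexity_separation _ _ _ _ _ _ id Posz hK hK') => _ [h hr <-].
have [W hW [mW dW]] := acceptable_stages ha hr.
(* Admissible sequences are then the duplicate-free ones. This [V] ignores the stage, so the
   universal quantifier is void and the sets are r.e. *)
pose V (q x y t : nat) := x == y.
have hV : computable4 V by rewrite /V; comp.
have G b : exists2 h' : word -> word, total_recursive h' & forall p n,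
    [set x | exists z, below_config W V b (4 ^ numeral (choice.pickle p)) x z 0]
      #= `I_n -> cardinal (domain (phi (h' p))) = Some n.
  pose B p x z t := below_config W V b (4 ^ numeral p) x z t.
  have hB : computable4 B by exact: comp_below_config.
  by apply: (card_index (D := fun p x z => B p x z 0)) => //; comp.
have [h1 hr1 hE1] := G 1; have [h0 hr0 hE0] := G 0.
have [||D FD hD] := @Delta_sub (cardinal_family phi)
  (fun p => cardinal (domain (phi (h1 p)))) (fun p => cardinal (domain (phi (h0 p)))).
- by exists h1.
- by exists h0.
exists D => // p; have [S [n [hcard missing]]] :=
  @below_config_card W V (4 ^ numeral (choice.pickle p)) mW.
have Sigma1 b : b <= 1 -> [set x | exists z,
    below_config W V b (4 ^ numeral (choice.pickle p)) x z 0]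
    #= `I_((4 ^ numeral (choice.pickle p)).+1 * S + b * n).
  move=> b1; rewrite -hcard //.
  suff -> : [set x | exists z,
      below_config W V b (4 ^ numeral (choice.pickle p)) x z 0] =
    [set x | exists z, forall t,
      below_config W V b (4 ^ numeral (choice.pickle p)) x z t] by exact: card_eqxx.
  by apply/seteqP; split=> x [z hz]; exists z.
exists n.
  rewrite (hD _ _ _ (hE1 _ _ (Sigma1 1 isT)) (hE0 _ _ (Sigma1 0 isT))).
  by congr Some; lia.
move=> q /pickle_below /missing no /cardinalP hq; apply: no.
have adm xs : admissible W V (choice.pickle q) xs <->
    uniq xs /\ forall x, x \in xs -> domain (phi (h q)) x.
  split=> [[h2 h3]|[us xsd]].
    split=> [|x /(nthP 0)[k /h2 e <-]]; last by apply/dW.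
    apply/(uniqP 0) => k l; rewrite !inE => kx lx e; apply/eqP.
    case: (ltngtP k l) => // lt.
      by have := h3 l k lx lt 0; rewrite /V e eqxx.
    by have := h3 k l kx lt 0; rewrite /V e eqxx.
  split=> [k kx|k l kx lk t]; first by apply/dW/xsd/mem_nth.
  by rewrite /V nth_uniq ?(ltn_trans lk) // neq_ltn lk.
have /card_uniq_seq[xs [us sx dx]] := hq.
exists xs; split=> // [|ys /adm[uy ysd]]; last exact: card_size_le hq uy ysd.
by apply/adm; split=> // x xx; rewrite dx.
Qed.

Lemma index_not_le_Delta phi K K' : acceptable phi ->
  complexity (eqv_index_family phi) K ->
  complexity (Delta (eqv_index_family phi)) K' -> ~ le_ct K (restrict_nat K').
Proof.
move=> ha hK hK'.
apply: (@complexity_separation _ _ _ _ _ _ id Posz hK hK') => _ [h hr <-].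
have [W hW [mW dW]] := acceptable_stages ha hr.
(* The points are those related to themselves, and related pairs are forbidden: admissible sequences
   represent distinct classes. Avoiding related pairs is a Pi_1 condition, which makes the sets
   Sigma_2. *)
pose E q x t := W q (kpair x x) t.
pose V q x y t := W q (kpair x y) t.
have hE : computable3 E by move: comp_kpair => ?; rewrite /E; comp.
have hV : computable4 V by move: comp_kpair => ?; rewrite /V; comp.
have G b : exists2 h' : word -> word, total_recursive h' & forall p n,
    [set x | exists z, forall t,
      below_config E V b (4 ^ numeral (choice.pickle p)) x z t] #= `I_n ->
    eqv_index (domain (phi (h' p))) = Some n.+1.
  exact: (eqv_index_index (D := fun p x z t => below_config E V b (4 ^ numeral p) x z t))
    ha (comp_below_config b hE hV).
have [h1 hr1 hE1] := G 1; have [h0 hr0 hE0] := G 0.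
have [||D FD hD] := @Delta_sub (eqv_index_family phi)
  (fun p => eqv_index (domain (phi (h1 p)))) (fun p => eqv_index (domain (phi (h0 p)))).
- by exists h1.
- by exists h0.
exists D => // p; have [|S [n [hcard missing]]] :=
  @below_config_card E V (4 ^ numeral (choice.pickle p)).
  by move=> q x t t'; exact: mW.
exists n.
  have c b : b <= 1 -> [set x | exists z, forall t,
      below_config E V b (4 ^ numeral (choice.pickle p)) x z t]
      #= `I_((4 ^ numeral (choice.pickle p)).+1 * S + b * n).
    by move=> /hcard ->; exact: card_eqxx.
  (* The dead class adds one to both indices and cancels in the difference. *)
  rewrite (hD _ _ _ (hE1 _ _ (c 1 isT)) (hE0 _ _ (c 0 isT))).
  by congr Some; lia.
move=> q /pickle_below /missing no /theP[A eA hq]; apply: no.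
set rho := domain _ in eA hq; have [sub refl sym tr] := eA.
have rhoE x y : rho (x, y) <-> exists t, W (choice.pickle q) (kpair x y) t.
  by rewrite /rho dW pickle_kpair.
pose cl x := [set y | rho (x, y)].
have adm xs : admissible E V (choice.pickle q) xs <->
    uniq (map cl xs) /\ forall x, x \in xs -> A x.
  split=> [[h2 h3]|[us xsA]].
    have xsA x : x \in xs -> A x.
      by move=> /(nthP 0)[k /h2 /rhoE /sub[] + _ <-].
    split=> //; apply/(uniqP (cl 0)) => k l; rewrite !inE !size_map => kx lx.
    rewrite !(nth_map 0) // => e; apply/eqP.
    have rel i j : i < size xs -> j < size xs ->
        cl (nth 0 xs i) = cl (nth 0 xs j) -> rho (nth 0 xs j, nth 0 xs i).
      by move=> ix jx /(classes_refl _ eA (xsA _ (mem_nth 0 ix))).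
    case: (ltngtP k l) => // lt.
      have /rhoE[t Vt] := rel _ _ lx kx (esym e).
      by case/negP: (h3 l k lx lt t).
    have /rhoE[t Vt] := rel _ _ kx lx e.
    by case/negP: (h3 k l kx lt t).
  split=> [k kx|k l kx lk t]; first by apply/rhoE/refl/xsA/mem_nth.
  apply/negP => Vt; have lx := ltn_trans lk kx.
  have /(classes_refl _ eA (xsA _ (mem_nth 0 kx))) e :
    rho (nth 0 xs l, nth 0 xs k) by apply/rhoE; exists t.
  have := nth_uniq (cl 0) (s := map cl xs) (i := k) (j := l).
  rewrite !size_map !(nth_map 0) // => /(_ kx lx us).
  by rewrite [cl _]e eqxx => /esym/eqP ekl; rewrite ekl ltnn in lk.
have /card_uniq_seq[s [us ss es]] := hq.
have [xs xsA exs] : exists2 xs, (forall x, x \in xs -> A x) & map cl xs = s.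
  have : forall C, C \in s -> classes A rho C by move=> C Cs; rewrite es.
  elim: s {us ss es} => [|C s IH] hs; first by exists [::].
  have [|xs xsA <-] := IH; first by move=> C' Cs; apply: hs; rewrite inE Cs orbT.
  have [|x Ax <-] := hs C; first by rewrite inE eqxx.
  by exists (x :: xs) => // y; rewrite inE => /predU1P[->|/xsA].
exists xs; split=> [||ys /adm[uy yA]].
- by apply/adm; rewrite exs.
- by rewrite -ss -exs size_map.
rewrite -(size_map cl); apply: card_size_le hq uy _.
by move=> C /mapP[y /yA Ay ->]; exists y.
Qed.

Theorem theorem1p5
  (phi1 : word -> nat -> option nat) (phi2 : word -> nat * nat -> option nat)
  (K_Church K_card K_index : nat -> nat)
  (KZ_Church KZ_DeltaChurch KZ_Deltacard KZ_Deltaindex : int -> nat)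
  (acceptable_phi1 : acceptable phi1)
  (acceptable_phi2 : acceptable phi2)
  (hChurch : complexity Church_nat_family K_Church)
  (hcard : complexity (cardinal_family phi1) K_card)
  (hindex : complexity (eqv_index_family phi2) K_index)
  (hZChurch : complexity Church_int_family KZ_Church)
  (hDeltaChurch : complexity (Delta Church_nat_family) KZ_DeltaChurch)
  (hDeltacard : complexity (Delta (cardinal_family phi1)) KZ_Deltacard)
  (hDeltaindex : complexity (Delta (eqv_index_family phi2)) KZ_Deltaindex) :
  (eq_ct K_Church (restrict_nat KZ_Church) /\
   eq_ct (restrict_nat KZ_Church) (restrict_nat KZ_DeltaChurch)) /\
  [/\ gt_ct log2 K_Church,
      gt_ct K_Church K_card,
      gt_ct K_card (restrict_nat KZ_Deltacard),
      gt_ct (restrict_nat KZ_Deltacard) K_index &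
      gt_ct K_index (restrict_nat KZ_Deltaindex)].
Proof.
have dC := Church_nat_describes; have dZ := Church_int_describes.
have dD := Delta_describes dC.
split; first split; split.
- exact: describes_le hZChurch hChurch dZ dC.
- exact: describes_le hChurch hZChurch dC dZ.
- exact: describes_le hDeltaChurch hZChurch dD dZ.
- exact: describes_le hZChurch hDeltaChurch dZ dD.
- exact: log2_gt_Church hChurch dC.
- exact: Church_gt_card acceptable_phi1 hChurch dC hcard.
- split; first exact: card_ge_Delta acceptable_phi1 hcard hDeltacard.
  exact: card_not_le_Delta acceptable_phi1 hcard hDeltacard.
- split; first exact: Delta_card_ge_index acceptable_phi1 acceptable_phi2 hDeltacard hindex.
  exact: Delta_card_not_le_index acceptable_phi1 acceptable_phi2 hDeltacard hindex.
- split; first exact: index_ge_Delta acceptable_phi2 hindex hDeltaindex.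
  exact: index_not_le_Delta acceptable_phi2 hindex hDeltaindex.
Qed.
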